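(* Let $G$ be a finitely presented group, and let $p$ be a prime. Then the following are equivalent: 1. $G$ is large; 2. some finite index subgroup of $G$ has an abelian $p$-series with rapid descent.
   Context: A group is large if it has a finite index subgroup that admits a surjective homomorphism onto a free non-abelian group. For a group $H$, $d_p(H)$ is the dimension of $H_1(H;\mathbb{F}_p)$ over the field $\mathbb{F}_p$ of order $p$. An abelian $p$-series for a group $H$ is a sequence of finite index subgroups $H=H_1\triangleright H_2\triangleright H_3\triangleright\cdots$ (each $H_{i+1}$ normal in $H_i$) such that $H_i/H_{i+1}$ is an elementary abelian $p$-group for each natural number $i$. It has rapid descent if $\inf_i d_p(H_i/H_{i+1})/[H:H_i]>0$. *)

(* Defs.v *)
From HB Require Import structures.
From mathcomp Require Import all_boot all_order all_algebra finmap.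
From mathcomp Require Import boolp classical_sets functions cardinality reals.
From mathcomp Require Import freeg.

Set Implicit Arguments.
Unset Strict Implicit.
Unset Printing Implicit Defensive.

Import Order.TTheory GRing.Theory Num.Theory.

Local Open Scope classical_set_scope.
Local Open Scope group_scope.

(* A subgroup of [G : groupType] is an [N : groupClosed G], i.e. a predicate on
   [G] closed under the group operations. *)

Notation "{ 'hom' G '->' H }" := (UMagmaMorphism.type G H)
  (at level 0, G at level 98, H at level 99, format "{ 'hom'  G  ->  H }")
  : type_scope.

Section Subgroups.
Variable G : groupType.
Implicit Types (H N : groupClosed G) (x y : G).

Record subgroup H := Subgroup { subgroup_val : G; _ : subgroup_val \in H }.

HB.instance Definition _ H := [isSub for @subgroup_val H].
HB.instance Definition _ H := [Choice of subgroup H by <:].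

Fact subgroup_closed H : group_closed [pred x | x \in H].
Proof. by split=> [|x y]; rewrite ?inE ?gpred1//; exact: gpredF. Qed.

HB.instance Definition _ H :=
  SubChoice_isSubGroup.Build G _ (subgroup H) (subgroup_closed H).

Definition lcoset x N : set G := [set x * y | y in [set` N]].

Definition lcosets N : set (set G) := range (lcoset^~ N).

Definition finite_index N : Prop := finite_set (lcosets N).

(* The junk value for an infinite index is 0. *)
Definition subgroup_index N : nat := #|` fset_set (lcosets N)|.

Definition normalises x (N : {pred G}) : Prop :=
  forall y, (y ^ x \in N) = (y \in N).

Definition normal_in (N H : {pred G}) : Prop :=
  {subset N <= H} /\ {in H, forall x, normalises x N}.

Definition normal_closure (A : set G) : set G :=
  [set x | forall N, normal_in N predT -> A `<=` [set` N] -> x \in N].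

End Subgroups.

(* H / N. As for [coset_of] in fingroup, the definition makes sense without
   assuming that N is a normal subgroup of H: the elements are the left cosets
   x N of the x in H that normalise N, so all the x in H when N is normal in
   H. *)
Section Quotient.
Variables (G : groupType) (H N : groupClosed G).
Implicit Types x y : G.

Definition is_coset (C : set G) : Prop :=
  exists x, [/\ x \in H, normalises x N & C = lcoset x N].

Record quotient_group :=
  Quotient { quotient_val : set G; _ : `[< is_coset quotient_val >] }.

HB.instance Definition _ := [isSub for quotient_val].
HB.instance Definition _ := [Choice of quotient_group by <:].

Implicit Types A B C : quotient_group.

Lemma quotientP C : is_coset (val C).
Proof. by apply/asboolP; exact: valP C. Qed.

Lemma mem_lcoset x y : lcoset x N y <-> x^-1 * y \in N.
Proof.
split=> [[z zN <-]|xyN]; first by rewrite mulKg.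
by exists (x^-1 * y); rewrite ?mulVKg.
Qed.

Lemma normalisesM x y : normalises x N -> normalises y N -> normalises (x * y) N.
Proof. by move=> nx ny z; rewrite conjgM ny nx. Qed.

Lemma normalisesV x : normalises x N -> normalises x^-1 N.
Proof. by move=> nx z; rewrite -(nx (z ^ x^-1)) -conjgM mulVg conjg1. Qed.

Definition mul_set (A B : set G) : set G := [set a * b | a in A & b in B].

Definition inv_set (A : set G) : set G := [set a^-1 | a in A].

Lemma lcosetM x y : normalises y N ->
  mul_set (lcoset x N) (lcoset y N) = lcoset (x * y) N.
Proof.
move=> ny; apply/seteqP; split=> [_ [a /mem_lcoset aN [b /mem_lcoset bN <-]]|c /mem_lcoset cN].
  apply/mem_lcoset; rewrite invgM.
  have -> : y^-1 * x^-1 * (a * b) = (x^-1 * a) ^ y * (y^-1 * b).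
    by rewrite /conjg !mulgA mulgK.
  by rewrite gpredM// ny.
exists x; first by apply/mem_lcoset; rewrite mulVg gpred1.
exists (x^-1 * c); last by rewrite mulVKg.
by apply/mem_lcoset; rewrite mulgA -invgM.
Qed.

Lemma lcosetV x : normalises x N -> inv_set (lcoset x N) = lcoset x^-1 N.
Proof.
move=> nx.
have VN c : (x^-1 * c^-1 \in N) = (x * c \in N).
  by rewrite -(nx (x * c)) -(gpredV _ (_ ^ x)) /conjg mulgA mulKg invgM.
apply/seteqP; split=> [_ [a /mem_lcoset aN <-]|c /mem_lcoset cN].
  by apply/mem_lcoset; rewrite invgK -VN invgK.
exists c^-1; last by rewrite invgK.
by apply/mem_lcoset; rewrite VN -[x]invgK.
Qed.

Fact quotient_mul_subproof A B : `[< is_coset (mul_set (val A) (val B)) >].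
Proof.
have [x [xH nx ->]] := quotientP A; have [y [yH ny ->]] := quotientP B.
apply/asboolP; exists (x * y); split; rewrite ?lcosetM ?gpredM//.
exact: normalisesM.
Qed.

Fact quotient_inv_subproof A : `[< is_coset (inv_set (val A)) >].
Proof.
have [x [xH nx ->]] := quotientP A; apply/asboolP.
by exists x^-1; split; rewrite ?lcosetV ?gpredV//; exact: normalisesV.
Qed.

Fact quotient_one_subproof : `[< is_coset (lcoset 1 N) >].
Proof. by apply/asboolP; exists 1; split; rewrite ?gpred1// => y; rewrite conjg1. Qed.

Definition quotient_mul A B := Quotient (quotient_mul_subproof A B).
Definition quotient_inv A := Quotient (quotient_inv_subproof A).
Definition quotient_one := Quotient quotient_one_subproof.

Fact quotient_mulA : associative quotient_mul.
Proof.
move=> A B C; apply: val_inj => /=.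
have [x [_ nx ->]] := quotientP A; have [y [_ ny ->]] := quotientP B.
have [z [_ nz ->]] := quotientP C.
by rewrite !lcosetM ?mulgA//; exact: normalisesM.
Qed.

Fact quotient_mul1g : left_id quotient_one quotient_mul.
Proof.
move=> A; apply: val_inj => /=; have [x [_ nx ->]] := quotientP A.
by rewrite lcosetM ?mul1g.
Qed.

Fact quotient_mulg1 : right_id quotient_one quotient_mul.
Proof.
move=> A; apply: val_inj => /=; have [x [_ nx ->]] := quotientP A.
by rewrite lcosetM ?mulg1// => y; rewrite conjg1.
Qed.

Fact quotient_mulVg : left_inverse quotient_one quotient_inv quotient_mul.
Proof.
move=> A; apply: val_inj => /=; have [x [_ nx ->]] := quotientP A.
by rewrite lcosetV// lcosetM ?mulVg.
Qed.

Fact quotient_mulgV : right_inverse quotient_one quotient_inv quotient_mul.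
Proof.
move=> A; apply: val_inj => /=; have [x [_ nx ->]] := quotientP A.
by rewrite lcosetV// lcosetM ?mulgV//; exact: normalisesV.
Qed.

HB.instance Definition _ := isGroup.Build quotient_group quotient_mulA quotient_mul1g
  quotient_mulg1 quotient_mulVg quotient_mulgV.

End Quotient.

Section Free.
Variable F : groupType.

Definition free_basis (X : set F) : Prop :=
  forall (K : groupType) (f : F -> K),
    exists2 phi : {hom F -> K}, {in X, phi =1 f} &
      forall psi : {hom F -> K}, {in X, psi =1 f} -> psi =1 phi.

Definition is_free : Prop := exists X, free_basis X.

Definition non_abelian : Prop := exists x y : F, x * y <> y * x.

End Free.

Definition surj_hom (G K : groupType) (f : {hom G -> K}) : Prop :=
  forall y, exists x, f x = y.

Definition finitely_presented (G : groupType) : Prop :=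
  exists (F : groupType) (X R : set F) (f : {hom F -> G}),
    [/\ free_basis X, finite_set X, finite_set R, surj_hom f &
        [set x | f x = 1] = normal_closure R].

Definition large (G : groupType) : Prop :=
  exists2 H : groupClosed G, finite_index H &
    exists (F : groupType) (f : {hom subgroup H -> F}),
      [/\ is_free F, non_abelian F & surj_hom f].

(* H_1(Q; F_p) is computed from the bar complex of Q with coefficients in F_p:
   the 1-chains are the free F_p-module on Q, every 1-chain is a cycle, and the
   boundary of the 2-cell [x|y] is [y] - [xy] + [x]. *)
Section Homology.
Variables (p : nat) (Q : groupType).

Definition chain1 := {freeg Q / 'F_p}.

Definition bar_boundary (x y : Q) : chain1 := (<<y>> - <<x * y>>%g + <<x>>)%R.

Definition boundaries1 : set chain1 :=
  [set c | forall S : submodClosed chain1,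
             (forall x y, bar_boundary x y \in S) -> c \in S].

End Homology.

(* The subspace W has codimension d in V, i.e. V / W has dimension d. *)
Definition quotient_dim (K : fieldType) (V : lmodType K) (W : set V) (d : nat) :=
  exists2 phi : {linear V -> 'rV[K]_d},
    (forall u, exists v, phi v = u) & [set v | phi v = 0%R] = W.

(* d_p(Q), with junk value 0 if H_1(Q; F_p) is infinite-dimensional. *)
Definition dim_H1 (p : nat) (Q : groupType) : nat :=
  xget 0%N [set d | quotient_dim (@boundaries1 p Q) d].

Definition elementary_abelian (p : nat) (Q : groupType) : Prop :=
  (forall x y : Q, x * y = y * x) /\ (forall x : Q, x ^+ p = 1).

(* [S i] is the term H_{i+1} of the series. *)
Definition abelian_p_series (p : nat) (H : groupType)
    (S : nat -> groupClosed H) : Prop :=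
  [/\ S 0%N =i predT,
      forall i, finite_index (S i),
      forall i, normal_in (S i.+1) (S i) &
      forall i, elementary_abelian p (quotient_group (S i) (S i.+1))].

Definition rapid_descent (R : realType) (p : nat) (H : groupType)
    (S : nat -> groupClosed H) : Prop :=
  (0 < inf (range (fun i =>
     (dim_H1 p (quotient_group (S i) (S i.+1)))%:R / (subgroup_index (S i))%:R : R)))%R.

(* Main.v *)
Require Import Defs.
From HB Require Import structures.
From mathcomp Require Import all_boot all_order all_fingroup all_algebra finmap.
From mathcomp Require Import boolp classical_sets functions cardinality reals.
From mathcomp Require Import freeg generic_quotient.
From mathcomp Require Import ring zify.

(** Think of a finite transitive right G-set V as a finite cover of a presentation
complex of G: its vertices are the points of V, its edges the pairs (v, l) with l a
letter, and its 2-cells the pairs of a point and a relator. A class in the first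
cohomology of the cover with coefficients in A is given by a cocycle
u : V -> G -> A, and labels of the edges come from a cocycle exactly when their
product along each 2-cell is 1 ([extend_cocycle]). A cocycle with values in a finite
group A defines a further cover [skew], with point set V x A.

Suppose that some finite index subgroup has a series with rapid descent. The terms of
the series are the stabilisers of the base points in a tower of covers V_0, V_1, ...,
where V_(i+1) is the skew product of V_i by a cocycle u_i with values in F_p^(d_i),
and |V_i| <= M d_i for a constant M. Largeness of G follows from two facts.

First, cocycles can be made thin ([shrink_support]). Let w be a cocycle on V_i with
values in F_p^m. On V_(i+1) the coordinates f_a of the fibre are primitives of the
components of u_i, and the cochains sum lam_ab f_a w_b are closed as soon as
|rs| |V_i| linear conditions on lam hold, because the coboundary of f_a w_b is pulled
back from V_i. As there are d_i m coefficients, and d_i m is much larger than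
|rs| |V_i| when m is a large constant, m independent closed combinations exist, and
their classes can be kept independent at the price of m^2 further conditions. On an
edge where w is zero these combinations vanish on the whole fibre; on the other edges
they are linear in the fibre coordinate, hence they all vanish on a proportion at
least p^-m of the fibre. So each step of the tower multiplies the density of the
support by at most 1 - p^-m, and the density becomes as small as needed.

Second, a cover with many cocycles and one thin cocycle w makes G large
([thin_large]). Since d_i is much larger than the support of w, there are nonzero
cocycles z1, z2 vanishing on a spanning tree and on all 2-cells that meet the support
of w. No 2-cell sees both w and z = (z1, z2), so w and z define a homomorphism from
the stabiliser of the base point onto the free product of F_p and F_p^2. The kernel of
the map of this free product to F_p x F_p^2 is free of rank at least 2. Here it is
reached directly by a cocycle with values in the free group of rank 2 on the cover
defined by (w, z) ([disjoint_cocycle], [disjoint_large]).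

Conversely, if a finite index subgroup K maps onto a non-abelian free group, it maps
onto the free group of rank 2. A cover of the rose with two petals with n vertices has
at least n + 1 edges outside a spanning tree, and hence a further cover with deck
group F_p^d, d > n ([free2_cover]). The tower of these covers, pulled back to K, is a
series with rapid descent ([onto_free2_descent]). *)

Set Implicit Arguments.
Unset Strict Implicit.
Unset Printing Implicit Defensive.

Import Defs.
Import Order.TTheory GRing.Theory Num.Theory.

Local Open Scope classical_set_scope.
Local Open Scope group_scope.

(** * Homomorphisms and subgroups given by plain functions and predicates *)

Section HomOf.
Variables (G K : groupType) (f : G -> K).
Hypothesis fM : {morph f : x y / x * y}.

Let f1 : f 1 = 1.
Proof. by apply: (mulgI (f 1)); rewrite -fM !mulg1. Qed.

Definition hom_of : {hom G -> K} :=
  HB.pack f (isUMagmaMorphism.Build G K f (f1, fM)).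

End HomOf.

Section ClosedOf.
Variables (G : groupType) (P : G -> Prop).
Hypotheses (P1 : P 1) (PF : forall x y, P x -> P y -> P (x * y^-1)).

Definition asbool_pred : {pred G} := fun x => `[< P x >].

Let PV x : P x -> P x^-1.
Proof. by move=> Px; rewrite -[x^-1]mul1g; exact: PF. Qed.

Let asP x : reflect (P x) (x \in asbool_pred). Proof. exact: asboolP. Qed.

Let predM : mulg_closed asbool_pred.
Proof.
by move=> x y /asP Px /asP Py; apply/asP; rewrite -[y]invgK; apply: PF => //; exact: PV.
Qed.

Let pred1 : 1 \in asbool_pred. Proof. exact/asP. Qed.

Let predV : invg_closed asbool_pred.
Proof. by move=> x /asP Px; apply/asP; exact: PV. Qed.

Definition closed_of : groupClosed G :=
  HB.pack asbool_pred (isMulClosed.Build G asbool_pred predM)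
    (isMul1Closed.Build G asbool_pred pred1) (isInvClosed.Build G asbool_pred predV).

Lemma closed_ofP x : reflect (P x) (x \in closed_of).
Proof. exact: asP. Qed.
End ClosedOf.

(** * Pointed finite G-sets, cocycles and covers *)

Section GSets.
Variable G : groupType.

(** [act] is a right action, so that words are read from left to right along paths.
    The stabiliser of [base] is the fundamental group of the corresponding cover. *)
Record gset := GSet {
  pt :> finType;
  act : pt -> G -> pt;
  base : pt;
  act1 : forall v, act v 1 = v;
  actM : forall v g h, act v (g * h) = act (act v g) h }.

Definition transitive_gset (V : gset) := forall v : V, exists g, act (base V) g = v.

(** Evaluation of a 1-cocycle along the path that starts at v and spells g. Restricted
    to the stabiliser of v it is a homomorphism. *)
Definition cocycle (V : gset) (A : groupType) (u : V -> G -> A) :=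
  forall v g h, u v (g * h) = u v g * u (act v g) h.

Implicit Type V : gset.

Lemma actK V g : cancel (fun v : V => act v g) (fun v => act v g^-1).
Proof. by move=> v; rewrite -actM mulgV act1. Qed.

Lemma actKV V g : cancel (fun v : V => act v g^-1) (fun v => act v g).
Proof. by move=> v; rewrite -actM mulVg act1. Qed.

Lemma cocycle1 V (A : groupType) (u : V -> G -> A) : cocycle u -> forall v, u v 1 = 1.
Proof.
by move=> uc v; apply: (mulgI (u v 1)); rewrite -{2}[v]act1 -uc !mulg1.
Qed.

Lemma cocycleV V (A : groupType) (u : V -> G -> A) : cocycle u ->
  forall v g, u (act v g) g^-1 = (u v g)^-1.
Proof.
by move=> uc v g; apply: (mulgI (u v g)); rewrite -uc !mulgV cocycle1.
Qed.

Section Skew.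
Variables (V : gset) (A : finGroupType) (u : V -> G -> A) (uc : cocycle u).

Definition skew_act (x : V * A) g : V * A := (act x.1 g, x.2 * u x.1 g).

Fact skew_act1 x : skew_act x 1 = x.
Proof. by rewrite /skew_act act1 cocycle1// mulg1; case: x. Qed.

Fact skew_actM x g h : skew_act x (g * h) = skew_act (skew_act x g) h.
Proof. by rewrite /skew_act/= actM uc mulgA. Qed.

(** The regular cover with deck group A determined by u. *)
Definition skew : gset := GSet (base V, 1) skew_act1 skew_actM.

(** Surjectivity on the loops at the base point: the condition for the cover defined
    by u to be connected. *)
Definition onto_loops := forall a, exists2 g, act (base V) g = base V & u (base V) g = a.

Lemma skew_transitive : transitive_gset V -> onto_loops -> transitive_gset skew.
Proof.
move=> tV su [v a]; have [g gv] := tV v; have [h hb ha] := su (a * (u (base V) g)^-1).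
by exists (h * g); rewrite /= /skew_act /= actM uc hb ha gv mul1g mulgVK.
Qed.

Lemma act_skew x g : act (x : skew) g = (act x.1 g, x.2 * u x.1 g). Proof. by []. Qed.

Lemma card_skew : #|skew| = (#|V| * #|A|)%N. Proof. exact: card_prod. Qed.

End Skew.

Section Stab.
Variable V : gset.

Let stabP (g : G) := act (base V) g = base V.
Let stabP1 : stabP 1. Proof. exact: act1. Qed.
Let stabPF g h : stabP g -> stabP h -> stabP (g * h^-1).
Proof. by rewrite /stabP actM => -> hb; rewrite -{1}hb actK. Qed.

Definition stab : groupClosed G := closed_of stabP1 stabPF.

Lemma stabE g : reflect (act (base V) g = base V) (g \in stab).
Proof. exact: closed_ofP. Qed.

Lemma lcoset_stab g h : lcoset g stab h <-> act (base V) h^-1 = act (base V) g^-1.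
Proof.
rewrite mem_lcoset; split=> [/stabE|] e.
  by rewrite -{1}e -actM mulgK.
by apply/stabE; rewrite actM -e actKV.
Qed.

Lemma finite_index_stab : finite_index stab.
Proof.
apply: (@sub_finite_set _ _ ((fun v => [set h | act (base V) h^-1 = v]) @` setT)).
  move=> _ [g _ <-]; exists (act (base V) g^-1) => //.
  by apply/seteqP; split=> h /lcoset_stab.
exact: finite_image.
Qed.

Lemma subgroup_index_stab : transitive_gset V -> subgroup_index stab = #|V|.
Proof.
move=> tV; rewrite /subgroup_index.
have inj : injective (fun v : V => [set h | act (base V) h^-1 = v] : set G).
  move=> v w /seteqP[vw _]; have [g gv] := tV v.
  by have := vw g^-1; rewrite /= invgK gv => ->.
have -> : lcosets stab = [set` [fset [set h | act (base V) h^-1 = v] | v in V]%fset].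
  apply/seteqP; split=> [_ [g _ <-]|C /= /imfsetP[v _ ->]].
    apply/imfsetP; exists (act (base V) g^-1) => //.
    by apply/seteqP; split=> h /lcoset_stab.
  have [g gv] := tV v; exists g^-1 => //; rewrite -gv.
  by apply/seteqP; split=> h; rewrite lcoset_stab invgK.
by rewrite set_fsetK card_imfset//= -cardE; apply: eq_card => v; rewrite inE.
Qed.

End Stab.

End GSets.

Arguments act : simpl never.

Lemma cocycleD (G : groupType) (V : gset G) (A : finZmodType) (u : V -> G -> A) :
  cocycle u -> forall v g h, u v (g * h) = (u v g + u (act v g) h)%R.
Proof. exact. Qed.

Lemma act_skewD (G : groupType) (V : gset G) (A : finZmodType) (u : V -> G -> A)
    (uc : cocycle u) v a g :
  act ((v, a) : skew uc) g = (act v g, (a + u v g)%R).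
Proof. by []. Qed.

Lemma base_skewD (G : groupType) (V : gset G) (A : finZmodType) (u : V -> G -> A)
    (uc : cocycle u) : base (skew uc) = (base V, 0%R).
Proof. by []. Qed.

Section CosetGSet.
Variables (G : groupType) (N : groupClosed G) (fN : finite_index N).

Let T : finType := fset_set (lcosets N).

Let memT C : (C \in fset_set (lcosets N)) = (C \in lcosets N).
Proof. exact: in_fset_set. Qed.

(** The points are left cosets, so a right action must translate by inverses. *)
Let shift (C : set G) (g : G) : set G := [set h | C (g * h)].

Let shift_lcoset h g : shift (lcoset h N) g = lcoset (g^-1 * h) N.
Proof.
by apply/seteqP; split=> k /mem_lcoset kN; apply/mem_lcoset;
  rewrite invgM invgK -?mulgA in kN *.
Qed.

Let coset_mem h : lcoset h N \in fset_set (lcosets N).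
Proof. by rewrite memT inE; exists h. Qed.

Let base0 : T := [` coset_mem 1]%fset.

Let coset_act (C : T) g : T := insubd base0 (shift (val C) g).

Let cosetP (C : T) : exists h, val C = lcoset h N.
Proof. by have := valP C; rewrite memT inE => -[h _ <-]; exists h. Qed.

Let val_coset_act C g : val (coset_act C g) = shift (val C) g.
Proof. by have [h hC] := cosetP C; rewrite insubdK// hC shift_lcoset; exact: coset_mem. Qed.

Let coset_act1 C : coset_act C 1 = C.
Proof.
by apply: val_inj; rewrite val_coset_act; apply/seteqP; split=> h; rewrite /shift /= mul1g.
Qed.

Let coset_actM C g h : coset_act C (g * h) = coset_act (coset_act C g) h.
Proof.
by apply: val_inj; rewrite !val_coset_act; apply/seteqP; split=> k; rewrite /shift /= mulgA.
Qed.

Lemma coset_gset : exists2 V : gset G, transitive_gset V &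
  forall g, act (base V) g = base V <-> g \in N.
Proof.
exists (GSet base0 coset_act1 coset_actM) => [C|g].
  have [h hC] := cosetP C; exists h^-1; apply: val_inj.
  by rewrite [LHS]val_coset_act /= shift_lcoset invgK mulg1.
split=> [/(congr1 val)|gN].
  rewrite [LHS]val_coset_act /= shift_lcoset mulg1 => /seteqP[_ /(_ 1)].
  have one : lcoset 1 N 1 by apply/mem_lcoset; rewrite mulVg gpred1.
  by move=> /(_ one)/mem_lcoset; rewrite invgK mulg1.
apply: val_inj; rewrite [LHS]val_coset_act /= shift_lcoset mulg1.
apply/seteqP; split=> h /mem_lcoset hN; apply/mem_lcoset; move: hN.
  by rewrite invgK invg1 mul1g gpredMl.
by rewrite invgK invg1 mul1g gpredMl.
Qed.
End CosetGSet.

(** The path g from v is closed up to a loop by chosen elements tau v that move the base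
    point to v. Taking tau to be 1 at the base point makes the cocycle agree with th on
    loops, instead of being only conjugate to it. *)
Lemma cocycle_of_hom (G : groupType) (V : gset G) (A : groupType) (th : G -> A) :
  transitive_gset V ->
  (forall g h, act (base V) g = base V -> act (base V) h = base V ->
     th (g * h) = th g * th h) ->
  exists2 u : V -> G -> A, cocycle u & forall g, act (base V) g = base V -> u (base V) g = th g.
Proof.
move=> tV thM.
have /choice[tau tauP] (v : V) : exists g, act (base V) g = v /\ (v = base V -> g = 1).
  have [->|nv] := eqVneq v (base V); first by exists 1; rewrite act1.
  by have [g gv] := tV v; exists g; split=> // e; rewrite e eqxx in nv.
have tauE v : act (base V) (tau v) = v by case: (tauP v).
have tau1 : tau (base V) = 1 by apply: (tauP _).2.
have tauV v : act v (tau v)^-1 = base V by rewrite -{1}(tauE v) actK.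
exists (fun v g => th (tau v * g * (tau (act v g))^-1)) => [v g h|g gb].
  rewrite -thM; last 2 first.
  - by rewrite !actM tauE tauV.
  - by rewrite !actM tauE tauV.
  by congr th; rewrite actM !mulgA mulgVK.
by rewrite gb tau1 invg1 mul1g mulg1.
Qed.

Section Pullback.
Variables (K F : groupType) (pi : {hom K -> F}) (V : gset F).

Let pull_act (v : V) (k : K) : V := act v (pi k).
Let pull_act1 v : pull_act v 1 = v. Proof. by rewrite /pull_act gmulf1 act1. Qed.
Let pull_actM v g h : pull_act v (g * h) = pull_act (pull_act v g) h.
Proof. by rewrite /pull_act gmulfM actM. Qed.

Definition pullback : gset K := GSet (base V) pull_act1 pull_actM.

Lemma act_pullback (v : V) k : act (v : pullback) k = act v (pi k). Proof. by []. Qed.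

Lemma pullback_transitive : surj_hom pi -> transitive_gset V -> transitive_gset pullback.
Proof.
move=> sp tV v; have [g gv] := tV v; have [k kg] := sp g.
by exists k; rewrite act_pullback kg.
Qed.
End Pullback.

(** * Presentations and the extension of cocycles *)

Section Presentations.
Variables (G : groupType) (L : finType) (x : L -> G).

(** The universal property is what a presentation is used for. Relators are positive
    words: where inverses of generators are needed, they are letters of their own. *)
Definition presents (rs : seq (seq L)) :=
  (forall r, r \in rs -> \prod_(l <- r) x l = 1) /\
  forall (K : groupType) (y : L -> K), (forall r, r \in rs -> \prod_(l <- r) y l = 1) ->
    exists2 phi : {hom G -> K}, (forall l, phi (x l) = y l) &
      forall psi : {hom G -> K}, (forall l, psi (x l) = y l) -> psi =1 phi.

(** Every element is a positive word in the letters, in the form of an induction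
    principle. *)
Definition word_generated :=
  forall P : G -> Prop, P 1 -> (forall g l, P g -> P (g * x l)) -> forall g, P g.

Fixpoint path_val (V : gset G) (A : groupType) (c : V -> L -> A) v s : A :=
  if s is l :: s' then c v l * path_val c (act v (x l)) s' else 1.

End Presentations.

Section Wreath.
Variables (G : groupType) (V : gset G) (A : groupType).

(** A homomorphism from G to this semidirect product that lifts the identity of G is the
    same thing as a cocycle on V with values in A. In this way the universal property of
    a presentation of G applies to cocycles. *)
Definition wreath := (G * {ffun V -> A})%type.
HB.instance Definition _ := Choice.on wreath.

Definition wreath_mul (a b : wreath) : wreath :=
  (a.1 * b.1, [ffun v => a.2 v * b.2 (act v a.1)]).
Definition wreath_one : wreath := (1, [ffun=> 1]).
Definition wreath_inv (a : wreath) : wreath :=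
  (a.1^-1, [ffun v => (a.2 (act v a.1^-1))^-1]).

Fact wreath_mulA : associative wreath_mul.
Proof.
move=> a b c; congr (_, _); first exact: mulgA.
by apply/ffunP=> v; rewrite !ffunE /= actM mulgA.
Qed.

Fact wreath_mul1g : left_id wreath_one wreath_mul.
Proof.
move=> [a f]; congr (_, _); first exact: mul1g.
by apply/ffunP=> v; rewrite !ffunE mul1g act1.
Qed.

Fact wreath_mulg1 : right_id wreath_one wreath_mul.
Proof.
move=> [a f]; congr (_, _); first exact: mulg1.
by apply/ffunP=> v; rewrite !ffunE mulg1.
Qed.

Fact wreath_mulVg : left_inverse wreath_one wreath_inv wreath_mul.
Proof.
move=> [a f]; congr (_, _); first exact: mulVg.
by apply/ffunP=> v; rewrite !ffunE mulVg.
Qed.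

Fact wreath_mulgV : right_inverse wreath_one wreath_inv wreath_mul.
Proof.
move=> [a f]; congr (_, _); first exact: mulgV.
by apply/ffunP=> v; rewrite !ffunE /= actK mulgV.
Qed.

HB.instance Definition _ := isGroup.Build wreath wreath_mulA wreath_mul1g
  wreath_mulg1 wreath_mulVg wreath_mulgV.

Lemma wreathM (a b : wreath) :
  a * b = (a.1 * b.1, [ffun v => a.2 v * b.2 (act v a.1)]). Proof. by []. Qed.
End Wreath.

(** A relator is trivial in [wreath] exactly when c has value 1 around it from every
    starting point. *)
Lemma extend_cocycle (G : groupType) (L : finType) (x : L -> G) rs (V : gset G)
    (A : groupType) (c : V -> L -> A) :
  presents x rs -> (forall r v, r \in rs -> path_val x c v r = 1) ->
  exists2 u : V -> G -> A, cocycle u & forall v l, u v (x l) = c v l.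
Proof.
move=> [xr univ] cr; pose y l : wreath V A := (x l, [ffun v => c v l]).
have yE s : \prod_(l <- s) y l = (\prod_(l <- s) x l, [ffun v => path_val x c v s]).
  elim: s => [|l s IHs]; first by rewrite !big_nil.
  rewrite !big_cons IHs wreathM; congr (_, _).
  by apply/ffunP=> v; rewrite !ffunE.
have [r rrs|phi phix _] := univ _ y.
  rewrite yE xr//; congr (_, _).
  by apply/ffunP=> v; rewrite !ffunE cr.
have phiM g h : phi (g * h) = phi g * phi h by exact: gmulfM.
have [id' _ id'1] := univ _ x xr.
have fstM : {morph (fun g => (phi g).1) : g h / g * h} by move=> g h; rewrite phiM.
have phi1 g : (phi g).1 = g.
  rewrite -[LHS]/(hom_of fstM g) id'1; last by move=> l /=; rewrite phix.
  by rewrite -(id'1 (hom_of (f := idfun) (fun _ _ => erefl))).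
exists (fun v g => (phi g).2 v) => [v g h|v l]; last by rewrite phix ffunE.
by rewrite phiM wreathM /= ffunE phi1.
Qed.

(** * Spanning trees of Schreier graphs *)

Section Tree.
Variables (G : groupType) (L : finType) (x : L -> G) (V : gset G).

(** The element g is spelled by a path from the base point along edges of T. The
    quantification over P spares the word that spells it. *)
Definition tree_path (T : {set V * L}) (g : G) :=
  forall P : G -> Prop, P 1 ->
    (forall h l, P h -> (act (base V) h, l) \in T -> P (h * x l)) -> P g.

(** Grow the set of points reached: while it is not everything, connectedness provides
    an edge that leaves it. *)
Lemma spanning_tree :
  (forall A : {set V}, base V \in A ->
     (forall v l, v \in A -> act v (x l) \in A) -> A = [set: V]%SET) ->
  exists2 T : {set V * L}, (#|T| < #|V|)%N &
    forall v, exists2 g, act (base V) g = v & tree_path T g.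
Proof.
move=> conn.
have grow n : (n < #|V|)%N -> exists (T : {set V * L}) (A : {set V}),
    [/\ (#|T| <= n)%N, #|A| = n.+1, base V \in A &
      forall v, v \in A -> exists2 g, act (base V) g = v & tree_path T g].
  elim: n => [|n IHn] nV.
    exists finset.set0, [set base V]%SET; rewrite cards0 cards1 set11; split=> // v /set1P->.
    by exists 1; rewrite ?act1.
  have [T [A [Tn An bA AT]]] := IHn (ltnW nV).
  have [v [l [vA vlA]]] : exists v l, v \in A /\ act v (x l) \notin A.
    apply: contrapT => no; have eA : A = [set: V]%SET.
      apply: conn => // v l vA; apply: contrapT => /negP vl; apply: no.
      by exists v, l.
    by move: nV; rewrite -cardsT -eA An ltnn.
  exists ((v, l) |: T)%SET, (act v (x l) |: A)%SET; split.
  - by rewrite cardsU1 -add1n leq_add// leq_b1.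
  - by rewrite cardsU1 vlA An.
  - by rewrite in_setU1 bA orbT.
  - have sub g : tree_path T g -> tree_path ((v, l) |: T)%SET g.
      by move=> Tg P P1 PM; apply: Tg => // h k Ph hT; apply: PM => //; rewrite in_setU1 hT orbT.
    move=> w /setU1P[->|/AT[g gw Tg]]; last first.
      by exists g; last exact: sub.
    have [g gv Tg] := AT v vA; exists (g * x l); first by rewrite actM gv.
    by move=> P P1 PM; apply: (PM); [exact: sub Tg _ P1 PM | rewrite gv setU11].
have V0 : (0 < #|V|)%N by apply/card_gt0P; exists (base V).
have [|T [A [Tn An _ AT]]] := grow #|V|.-1; first by rewrite prednK.
exists T; first by rewrite -(prednK V0).
have eA : A = [set: V]%SET.
  by apply/eqP; rewrite eqEcard finset.subsetT cardsT An prednK /=.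
by move=> v; apply: AT; rewrite eA inE.
Qed.

End Tree.

(** * The free group of rank two *)

Section FreeTwo.

Definition word_eval (K : groupType) (y : bool -> K) (s : seq (bool * bool)) : K :=
  \prod_(l <- s) (if l.2 then y l.1 else (y l.1)^-1).

Definition word_inv (s : seq (bool * bool)) := rev [seq (l.1, ~~ l.2) | l <- s].

Lemma word_evalM (K : groupType) (y : bool -> K) s t :
  word_eval y (s ++ t) = word_eval y s * word_eval y t.
Proof. exact: big_cat. Qed.

Lemma word_evalV (K : groupType) (y : bool -> K) s : word_eval y (word_inv s) = (word_eval y s)^-1.
Proof.
elim: s => [|[i e] s IHs]; first by rewrite /word_eval !big_nil invg1.
rewrite /word_inv /= rev_cons -cats1 word_evalM -/(word_inv s) IHs.
rewrite {2 3}/word_eval !big_cons big_nil mulg1 invgM; congr (_ * _).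
by case: e; rewrite /= ?invgK.
Qed.

Lemma hom_word_eval (K K' : groupType) (phi : {hom K -> K'}) y s :
  phi (word_eval y s) = word_eval (phi \o y) s.
Proof.
rewrite /word_eval gmulf_prod; apply: eq_bigr => -[i []] _ //=.
exact: gmulfV.
Qed.

(** Two words are equal in the free group when no pair of elements of a group tells them
    apart. With this as the definition, the universal property needs no normal form for
    words. *)
Definition word_eqv : rel (seq (bool * bool)) := fun s t =>
  `[< forall (K : groupType) (y : bool -> K), word_eval y s = word_eval y t >].

Fact word_eqv_refl : reflexive word_eqv. Proof. by move=> s; apply/asboolP. Qed.
Fact word_eqv_sym : symmetric word_eqv.
Proof. by move=> s t; apply/asboolP/asboolP=> e K y; rewrite e. Qed.
Fact word_eqv_trans : transitive word_eqv.
Proof.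
move=> t s r /asboolP st /asboolP tr; apply/asboolP=> K y.
by rewrite st tr.
Qed.

Canonical word_eqv_equiv := EquivRel word_eqv word_eqv_refl word_eqv_sym word_eqv_trans.

Definition free2 := {eq_quot word_eqv}%qT.
HB.instance Definition _ := Choice.on free2.

Definition of_word (s : seq (bool * bool)) : free2 := (\pi_({eq_quot word_eqv}) s)%qT.
Definition to_word (a : free2) : seq (bool * bool) := repr a.

Lemma of_word_eq s t :
  (forall (K : groupType) (y : bool -> K), word_eval y s = word_eval y t) ->
  of_word s = of_word t.
Proof. by move=> st; apply/eqquotP/asboolP. Qed.

Lemma to_wordK : cancel to_word of_word. Proof. exact: reprK. Qed.

Lemma of_wordK s (K : groupType) (y : bool -> K) :
  word_eval y (to_word (of_word s)) = word_eval y s.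
Proof.
have /eqquotP/asboolP : (\pi_({eq_quot word_eqv}) (to_word (of_word s)) =
   \pi_({eq_quot word_eqv}) s)%qT by rewrite reprK.
exact.
Qed.

Definition free2_mul a b := of_word (to_word a ++ to_word b).
Definition free2_inv a := of_word (word_inv (to_word a)).
Definition free2_one := of_word [::].

Lemma free2_ext (a b : free2) :
  (forall (K : groupType) (y : bool -> K), word_eval y (to_word a) = word_eval y (to_word b)) ->
  a = b.
Proof. by move=> ab; rewrite -[a]to_wordK -[b]to_wordK; exact: of_word_eq. Qed.

Fact free2_mulA : associative free2_mul.
Proof.
by move=> a b c; apply: free2_ext => K y; rewrite !(of_wordK, word_evalM) mulgA.
Qed.

Fact free2_mul1g : left_id free2_one free2_mul.
Proof.
move=> a; apply: free2_ext => K y; rewrite !(of_wordK, word_evalM).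
by rewrite [word_eval _ [::]]big_nil mul1g.
Qed.

Fact free2_mulg1 : right_id free2_one free2_mul.
Proof.
move=> a; apply: free2_ext => K y; rewrite !(of_wordK, word_evalM).
by rewrite [word_eval _ [::]]big_nil mulg1.
Qed.

Fact free2_mulVg : left_inverse free2_one free2_inv free2_mul.
Proof.
move=> a; apply: free2_ext => K y; rewrite !(of_wordK, word_evalM, word_evalV).
by rewrite [word_eval _ [::]]big_nil mulVg.
Qed.

Fact free2_mulgV : right_inverse free2_one free2_inv free2_mul.
Proof.
move=> a; apply: free2_ext => K y; rewrite !(of_wordK, word_evalM, word_evalV).
by rewrite [word_eval _ [::]]big_nil mulgV.
Qed.

HB.instance Definition _ := isGroup.Build free2 free2_mulA free2_mul1g
  free2_mulg1 free2_mulVg free2_mulgV.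

Definition gen2 (i : bool) : free2 := of_word [:: (i, true)].

Lemma free2_word (a : free2) : a = word_eval gen2 (to_word a).
Proof.
apply: free2_ext => K y; pose ev (a : free2) := word_eval y (to_word a).
have evM : {morph ev : a b / a * b}.
  by move=> b c; rewrite /ev of_wordK word_evalM.
rewrite -[RHS]/(hom_of evM _) hom_word_eval; apply: eq_bigr => l _ /=.
by rewrite /ev of_wordK /word_eval big_seq1.
Qed.

Lemma free2_presents : presents gen2 [::].
Proof.
split=> // K y _; pose ev (a : free2) := word_eval y (to_word a).
have evM : {morph ev : a b / a * b}.
  by move=> b c; rewrite /ev of_wordK word_evalM.
exists (hom_of evM) => [l|psi psiy a]; first by rewrite /= /ev of_wordK [LHS]big_seq1.
rewrite [in LHS](free2_word a) hom_word_eval /= /ev; apply: eq_bigr => l _.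
by rewrite /= psiy.
Qed.

Lemma free2_surj (K : groupType) (phi : {hom K -> free2}) :
  (forall i, exists g, phi g = gen2 i) -> surj_hom phi.
Proof.
move=> /choice[y yP] a; exists (word_eval y (to_word a)).
rewrite hom_word_eval [RHS]free2_word; apply: eq_bigr => l _.
by rewrite /= yP.
Qed.

Lemma free2_free : is_free free2.
Proof.
exists [set gen2 true; gen2 false] => K f.
have [|phi phif uniq] := free2_presents.2 K (f \o gen2); first by [].
exists phi => [a|psi psif]; first by rewrite inE => -[] ->; rewrite phif.
by apply: uniq => -[]; apply: psif; rewrite inE; [left | right].
Qed.

(** Two transpositions of three points distinguish the products in the two orders. *)
Lemma free2_non_abelian : non_abelian free2.
Proof.
exists (gen2 true), (gen2 false) => ab.
pose i0 : 'I_3 := ord0; pose i1 : 'I_3 := inord 1; pose i2 : 'I_3 := inord 2.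
pose y (b : bool) : {perm 'I_3} := if b then tperm i0 i1 else tperm i1 i2.
have [//|phi phiy _] := free2_presents.2 _ y.
have : phi (gen2 true * gen2 false) = phi (gen2 false * gen2 true) by rewrite ab.
rewrite !gmulfM !phiy => /permP/(_ i0).
have [i01 [i02 i12]] : i0 <> i1 /\ i0 <> i2 /\ i1 <> i2.
  by split; [|split] => /(congr1 val); rewrite /= !inordK.
rewrite !permM tpermL tpermL [tperm i1 i2 i0]tpermD; try by apply/eqP/nesym.
by rewrite tpermL => /nesym.
Qed.

End FreeTwo.

Section FreeBasis.
Variables (F : groupType) (X : set F).
Hypothesis basisX : free_basis X.

(** The homomorphism that retracts F on the subgroup defined by P agrees with the
    identity on the basis, hence everywhere. *)
Lemma free_basis_ind (P : F -> Prop) :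
  P 1 -> (forall a b, P a -> P b -> P (a * b^-1)) -> (forall a, X a -> P a) -> forall a, P a.
Proof.
move=> P1 PF PX; pose H := closed_of P1 PF.
pose i (a : F) : subgroup H := insubd 1 a.
have [phi phiX _] := basisX i.
have valM : {morph (fun a => val (phi a)) : a b / a * b} by move=> a b; rewrite gmulfM.
have [psi _ uniq] := basisX (idfun : F -> F).
have phiE a : val (phi a) = a.
  rewrite -[LHS]/(hom_of valM a) uniq.
    by rewrite -(uniq (hom_of (f := idfun) (fun _ _ => erefl))).
  move=> b bX /=; rewrite phiX// /i insubdK//; apply/(closed_ofP P1 PF); apply: PX.
  by rewrite inE in bX.
by move=> a; rewrite -(phiE a); apply/(closed_ofP P1 PF); apply: valP.
Qed.

End FreeBasis.

(** A basis whose elements are all equal would consist of a central element, and the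
    group would be abelian. So there are two different basis elements, which can be sent
    to the two generators. *)
Lemma free_non_abelian_onto (F : groupType) : is_free F -> non_abelian F ->
  exists phi : {hom F -> free2}, surj_hom phi.
Proof.
move=> [X basisX] [y0 [z0 yz]].
have [[a [b [Xa Xb ab]]]|no] := pselect (exists a b, [/\ X a, X b & a <> b]); last first.
  case: yz; have comm (P : F -> Prop) := free_basis_ind basisX (P := P).
  have Xcomm a y : X a -> commute a y.
    move=> Xa; apply: (comm (commute a)) => [|b c ab ac|b Xb].
    - exact: commute1.
    - by apply: commuteM => //; exact: commuteV.
    - have -> : b = a by apply: contrapT => ba; apply: no; exists b, a.
      exact: commute_refl.
  suff : commute z0 y0 by move=> ->.
  apply: (comm (commute z0)) => [|b c zb zc|b Xb].
  - exact: commute1.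
  - by apply: commuteM => //; exact: commuteV.
  - by apply: commute_sym; exact: Xcomm.
have [phi phiX _] := basisX free2 (fun c => gen2 (c == a)).
exists phi; apply: free2_surj => -[].
  by exists a; rewrite phiX ?inE// eqxx.
by exists b; rewrite phiX ?inE//; case: eqP => // ba; case: ab.
Qed.

(** * Finite presentations by positive words *)

(** The letters are the basis elements and their formal inverses; the relators that cancel
    a letter against its inverse are added to words for the elements of R. A homomorphism
    that kills R has a kernel that contains the normal closure of R, so it factors
    through f. *)
Lemma finitely_presented_words (G : groupType) : finitely_presented G ->
  exists (L : finType) (x : L -> G) (rs : seq (seq L)), presents x rs /\ word_generated x.
Proof.
move=> [F [X [R [f [basisX /finite_seqP[xs0 eX] /finite_seqP[R0 eR] fsurj kerf]]]]].
pose xs := undup xs0; have uxs : uniq xs by exact: undup_uniq.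
have xsE a : (a \in xs) <-> X a by rewrite mem_undup eX.
pose k := size xs; pose xF (i : 'I_k) : F := tnth (in_tuple xs) i.
pose L := ('I_k * bool)%type.
pose ev (K : groupType) (y : 'I_k -> K) (l : L) := if l.2 then y l.1 else (y l.1)^-1.
have words a : exists s : seq L, a = \prod_(l <- s) ev F xF l.
  move: a; apply: (free_basis_ind basisX) => [|a b [s ->] [t ->]|a /xsE axs].
  - by exists [::]; rewrite big_nil.
  - exists (s ++ rev [seq (l.1, ~~ l.2) | l <- t]); rewrite big_cat; congr (_ * _) => /=.
    elim: t => [|[i e] t IHt]; first by rewrite !big_nil invg1.
    rewrite /= rev_cons -cats1 big_cat big_cons invgM -IHt big_seq1.
    by congr (_ * _); rewrite /ev; case: e => /=; rewrite ?invgK.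
  - have ai : (index a xs < k)%N by rewrite index_mem.
    exists [:: (Ordinal ai, true)]; rewrite big_seq1 /ev /= /xF (tnth_nth a) /=.
    by rewrite nth_index.
have /choice[w wE] := words.
pose rs : seq (seq L) := [seq [:: (i, true); (i, false)] | i <- enum 'I_k] ++
  [seq w r | r <- R0].
have evhom (K : groupType) (phi : {hom F -> K}) s :
    phi (\prod_(l <- s) ev F xF l) = \prod_(l <- s) ev K (phi \o xF) l.
  rewrite gmulf_prod; apply: eq_bigr => -[i []] _ //=; exact: gmulfV.
exists L, (fun l => f (ev F xF l)), rs; split; last first.
  move=> P P1 PM g; have [a <-] := fsurj g; rewrite (wE a).
  elim/last_ind: (w a) => [|s l IHs]; first by rewrite big_nil gmulf1.
  by rewrite -cats1 big_cat big_seq1 gmulfM; exact: PM.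
have fR r : r \in R0 -> f r = 1.
  move=> rR; have : normal_closure R r.
    by move=> N _ RN; apply: RN; rewrite eR.
  by rewrite -kerf.
split=> [r|K y yrs].
  rewrite -gmulf_prod mem_cat => /orP[/mapP[i _ ->]|/mapP[a aR ->]].
    by rewrite big_cons big_seq1 /ev /= mulgV gmulf1.
  by rewrite -wE fR.
have yV i : y (i, false) = (y (i, true))^-1.
  apply/esym/mulg1_eq; have := yrs [:: (i, true); (i, false)].
  rewrite big_cons big_seq1; apply; rewrite mem_cat; apply/orP; left.
  by apply: map_f; rewrite mem_enum.
have yE l : y l = ev K (fun i => y (i, true)) l by case: l => i []; rewrite /ev //= yV.
pose f0 (a : F) : K := if insub (index a xs) is Some i then y (i, true) else 1.
have [phi phiX phiU] := basisX K f0.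
have phix i : phi (xF i) = y (i, true).
  have Xi : X (xF i) by apply/xsE; exact: mem_tnth.
  rewrite phiX ?inE// /f0 /xF (tnth_nth 1) index_uniq// insubT//= => ik.
  by congr (y (_, _)); apply: val_inj.
have phiE a : phi a = \prod_(l <- w a) y l.
  rewrite {1}(wE a) evhom; apply: eq_bigr => l _.
  by rewrite yE /ev /= phix.
have phi1F a b : phi a = 1 -> phi b = 1 -> phi (a * b^-1) = 1.
  by move=> a1 b1; rewrite gmulfF a1 b1 divg1.
have phi1 : phi 1 = 1 by exact: gmulf1.
pose kerphi := closed_of (P := fun a => phi a = 1) phi1 phi1F.
(* The kernel of f is the normal closure of R, so the kernel of phi contains it. *)
have fphi a : f a = 1 -> phi a = 1.
  move=> fa; have : normal_closure R a by rewrite -kerf.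
  move=> /(_ kerphi) ka; apply/(closed_ofP phi1 phi1F); apply: ka.
    split=> // b _ c; apply/closed_ofP/closed_ofP; rewrite gmulfJ.
      by move/eqP; rewrite conjg_eq1 => /eqP.
    by move=> ->; rewrite conj1g.
  rewrite eR => r rR; apply/closed_ofP; rewrite phiE yrs// mem_cat; apply/orP; right.
  exact: map_f.
have /choice[pre preE] : forall g, exists a, f a = g by [].
pose th g := phi (pre g).
have thE a : th (f a) = phi a.
  by apply: divg1_eq; rewrite -gmulfF; apply: fphi; rewrite gmulfF preE mulgV.
have thM : {morph th : g h / g * h}.
  by move=> g h; rewrite -{1}(preE g) -{1}(preE h) -gmulfM thE gmulfM.
exists (hom_of thM) => [l|psi psiy g]; first by rewrite /= thE yE; case: l => i [];
  rewrite /ev //= ?gmulfV ?phix.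
have psifM : {morph psi \o f : a b / a * b} by move=> a b; rewrite /= !gmulfM.
rewrite -(preE g) [RHS]thE -[LHS]/(hom_of psifM _) phiU// => a /[!inE] /xsE axs /=.
have ai : (index a xs < k)%N by rewrite index_mem.
have -> : a = ev F xF (Ordinal ai, true).
  by rewrite /ev /= /xF (tnth_nth a) /= nth_index.
by rewrite psiy /ev /= -phix phiX// inE; apply/xsE; exact: mem_tnth.
Qed.

(** * Two cocycles with disjoint supports *)

Section PathEdges.
Variables (G : groupType) (L : finType) (x : L -> G) (V : gset G).

Fixpoint path_edges (v : V) (s : seq L) : seq (V * L) :=
  if s is l :: s' then (v, l) :: path_edges (act v (x l)) s' else [::].

Lemma size_path_edges v s : size (path_edges v s) = size s.
Proof. by elim: s v => //= l s IHs v; rewrite IHs. Qed.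

Lemma path_edges_start v s e : e \in path_edges v s ->
  exists2 i, (i < size s)%N & v = act e.1 (\prod_(l <- take i s) x l)^-1.
Proof.
elim: s v => //= l s IHs v; rewrite inE => /orP[/eqP->|/IHs[i si ev]].
  by exists 0%N => //=; rewrite big_nil invg1 act1.
by exists i.+1 => //=; rewrite big_cons invgM actM -ev actK.
Qed.

(** The edges of the 2-cells that meet S. If the i-th edge of a 2-cell is e, the 2-cell
    starts at the point obtained from the origin of e by going back along the first i
    letters; so each edge of S and each i contribute one 2-cell per relator. *)
Definition touched_edges (rs : seq (seq L)) (S : seq (V * L)) : seq (V * L) :=
  flatten [seq flatten [seq flatten
    [seq path_edges (act e.1 (\prod_(l <- take i r) x l)^-1) r | e <- S]
    | i <- iota 0 (size r)] | r <- rs].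

Lemma touched_edgesP rs S r v : r \in rs ->
  {in path_edges v r, forall e, e \notin S} \/ {subset path_edges v r <= touched_edges rs S}.
Proof.
move=> rrs; have [/hasP[e ve eS]|/hasPn no] := boolP (has (mem S) (path_edges v r)); last by left.
right=> e' e've; have [i ir ev] := path_edges_start ve.
apply/flattenP; exists (flatten [seq flatten
    [seq path_edges (act e.1 (\prod_(l <- take i r) x l)^-1) r | e <- S]
    | i <- iota 0 (size r)]); first exact: map_f.
apply/flattenP; exists (flatten
  [seq path_edges (act e.1 (\prod_(l <- take i r) x l)^-1) r | e <- S]).
  by apply: map_f; rewrite mem_iota.
by apply/flattenP; exists (path_edges v r) => //; rewrite {1}ev; apply: map_f.
Qed.

Lemma size_flatten_map (I J : Type) (f : I -> seq J) s :
  size (flatten (map f s)) = (\sum_(i <- s) size (f i))%N.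
Proof. by rewrite size_flatten /shape -map_comp sumnE big_map. Qed.

Lemma size_touched_edges rs S :
  size (touched_edges rs S) = ((\sum_(r <- rs) size r ^ 2) * size S)%N.
Proof.
rewrite size_flatten_map big_distrl/=; apply: eq_bigr => r _.
rewrite size_flatten_map (eq_bigr (fun=> (size S * size r)%N)).
  by rewrite big_const_seq count_predT iter_addn_0 size_iota -mulnn -mulnA mulnC mulnAC.
move=> i _; rewrite size_flatten_map (eq_bigr (fun=> size r)).
  by rewrite big_const_seq count_predT iter_addn_0 mulnC.
by move=> e _; rewrite size_path_edges.
Qed.

End PathEdges.

Section Disjoint.
Variables (G : groupType) (L : finType) (x : L -> G) (rs : seq (seq L)).
Hypothesis presG : presents x rs.
Variables (V : gset G) (A B : finGroupType).
Variables (w : V -> G -> A) (z : V -> G -> B).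
Hypotheses (wc : cocycle w) (zc : cocycle z).

(** The element g is spelled by a path from v that runs, in either direction, along edges
    where z is trivial. *)
Definition zfree (v : V) (g : G) :=
  forall P : V -> G -> Prop, (forall v, P v 1) ->
    (forall v l, z v (x l) = 1 -> P v (x l)) ->
    (forall v g h, P v g -> P (act v g) h -> P v (g * h)) ->
    (forall v g, P v g -> P (act v g) g^-1) -> P v g.

Hypothesis disj : forall r v, r \in rs ->
  {in path_edges x v r, forall e, w e.1 (x e.2) = 1} \/
  {in path_edges x v r, forall e, z e.1 (x e.2) = 1}.
Hypothesis conn : forall v, exists2 g, act (base V) g = v & zfree (base V) g.
Hypothesis loops : forall a, exists g,
  [/\ act (base V) g = base V, zfree (base V) g & w (base V) g = a].

Let wz v g : A * B := (w v g, z v g).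
Let wzc : cocycle wz.
Proof. by move=> v g h; rewrite /wz wc zc. Qed.
Local Notation W := (skew wzc).

Lemma act_skew_pair v a b g :
  act ((v, (a, b)) : W) g = (act v g, (a * w v g, b * z v g)).
Proof. by []. Qed.

Variables (K : groupType) (X : A -> B -> K).

Let c (s : W) (l : L) : K := (X s.2.1 s.2.2)^-1 * X (s.2.1 * w s.1 (x l)) s.2.2.

Let c_relator r s : r \in rs -> path_val x c s r = 1.
Proof.
case: s => v [a b] rrs; have [w1|z1] := disj v rrs.
  elim: r v a b w1 {rrs} => //= l r IHr v a b w1.
  rewrite {1}/c /= (w1 (v, l)) ?mem_head// mulg1 mulVg mul1g.
  rewrite act_skew_pair; apply: IHr => e er; apply: w1.
  by rewrite inE er orbT.
have -> : path_val x c (v, (a, b)) r =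
    (X a b)^-1 * X (a * w v (\prod_(l <- r) x l)) b.
  elim: r v a b z1 {rrs} => /= [|l r IHr] v a b z1.
    by rewrite big_nil cocycle1// mulg1 mulVg.
  rewrite {1}/c act_skew_pair IHr.
    have /= -> := z1 (v, l) (mem_head _ _).
    by rewrite mulg1 big_cons wc !mulgA mulgK.
  by move=> e er; apply: z1; rewrite inE er orbT.
by rewrite presG.1// cocycle1// mulg1 mulVg.
Qed.

(** Label an edge from (a, b) to (a', b') by the inverse of X a b times X a' b. Along a
    2-cell where z is trivial b is constant and the product telescopes; along one where w
    is trivial each label is 1. This realises the map from the kernel of
    A free product B -> A x B to K determined by X. *)
Lemma disjoint_cocycle : exists2 Psi : W -> G -> K, cocycle Psi &
  (forall v g, zfree v g -> forall a b, Psi (v, (a, b)) g = (X a b)^-1 * X (a * w v g) b) /\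
  (forall v l, w v (x l) = 1 -> forall a b, Psi (v, (a, b)) (x l) = 1).
Proof.
have [Psi Psic PsiE] := extend_cocycle presG (fun r s rrs => c_relator s rrs).
exists Psi => //; split=> [v g zf a b|v l w1 a b]; last first.
  by rewrite PsiE /c /= w1 mulg1 mulVg.
pose P v g := z v g = 1 /\
  forall a b, Psi (v, (a, b)) g = (X a b)^-1 * X (a * w v g) b.
suff [] : P v g by [].
apply: zf => [{}v|{}v l z1|{}v {}g h [z1 Pg] [z2 Ph]|{}v {}g [z1 Pg]].
- by split=> [|a' b']; rewrite !cocycle1// mulg1 mulVg.
- by split=> // a' b'; rewrite PsiE.
- split=> [|a' b']; first by rewrite zc z1 z2 mulg1.
  by rewrite Psic Pg act_skew_pair z1 mulg1 Ph wc !mulgA mulgK.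
- split=> [|a' b']; first by rewrite cocycleV// z1 invg1.
  have := cocycleV Psic (v, (a' * (w v g)^-1, b')) g.
  rewrite act_skew_pair z1 mulg1 mulgVK => ->.
  by rewrite Pg invgM invgK mulgVK cocycleV.
Qed.

Lemma zfree_act v g : zfree v g -> forall a b,
  act ((v, (a, b)) : W) g = (act v g, (a * w v g, b)).
Proof.
move=> zf a b; rewrite act_skew_pair.
suff -> : z v g = 1 by rewrite mulg1.
apply: (zf (fun v g => z v g = 1)) => [v'|//|v' g' h z1 z2|v' g' z1]; first exact: cocycle1.
  by rewrite zc z1 z2 mulg1.
by rewrite cocycleV// z1 invg1.
Qed.

(** Go to the edge along z-trivial paths chosen so that the coordinate a is unchanged,
    cross the edge, and come back. The contributions of the way out and of the way back
    vanish, and so does that of the edge, because w is trivial there. *)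
Lemma loop_along_edge (Psi : W -> G -> K) v l : cocycle Psi ->
  (forall v g, zfree v g -> forall a b, Psi (v, (a, b)) g = (X a b)^-1 * X (a * w v g) b) ->
  (forall v l, w v (x l) = 1 -> forall a b, Psi (v, (a, b)) (x l) = 1) ->
  w v (x l) = 1 ->
  exists g, forall a b, act ((base V, (a, b)) : W) g = (base V, (a, b * z v (x l))) /\
    Psi (base V, (a, b)) g = 1.
Proof.
move=> Psic Psizf Psiw w1.
have zfV v' g : zfree v' g -> zfree (act v' g) g^-1.
  by move=> zf P P1 Pl PM PV; apply: (PV); exact: zf.
have zfM v' g h : zfree v' g -> zfree (act v' g) h -> zfree v' (g * h).
  by move=> zg zh P P1 Pl PM PV; apply: (PM); [exact: zg | exact: zh].
have out v' : exists g, [/\ act (base V) g = v', zfree (base V) g & w (base V) g = 1].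
  have [g gv zg] := conn v'; have [h [hb zh hw]] := loops (w (base V) g)^-1.
  exists (h * g); rewrite actM hb; split=> //; first by apply: zfM; rewrite ?hb.
  by rewrite wc hb hw mulVg.
have [g [gv zg gw]] := out v; have [h [hv zh hw]] := out (act v (x l)).
exists (g * x l * h^-1) => a b.
have actgl : act ((base V, (a, b)) : W) (g * x l) = (act v (x l), (a, b * z v (x l))).
  by rewrite actM (zfree_act zg) gv gw mulg1 act_skew_pair w1 mulg1.
have actV b' : act ((act v (x l), (a, b')) : W) h^-1 = (base V, (a, b')).
  by rewrite -[RHS](@actK _ W h) (zfree_act zh) hv hw mulg1.
rewrite actM actgl actV; split=> //.
rewrite Psic actgl Psic (zfree_act zg) gv gw mulg1 Psiw// (Psizf _ _ zg) gw !mulg1 mulVg mul1g.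
have := cocycleV Psic ((base V, (a, b * z v (x l))) : W) h.
by rewrite (zfree_act zh) hv hw mulg1 => ->; rewrite (Psizf _ _ zh) hw mulg1 mulVg invg1.
Qed.

End Disjoint.

(** X takes the two generators as values at the points (alpha, b) with b the value of z
    on one of the two given edges, and is trivial elsewhere, in particular when one of its
    arguments is trivial. The commutator of a z-trivial loop with monodromy alpha and a
    loop across such an edge runs around a rectangle in A x B, and picks up only the value
    of X at one corner. *)
Lemma disjoint_large (G : groupType) (L : finType) (x : L -> G) rs (V : gset G)
    (A B : finGroupType) (w : V -> G -> A) (z : V -> G -> B) (alpha : A) v1 l1 v2 l2 :
  presents x rs -> cocycle w -> cocycle z ->
  (forall r v, r \in rs ->
    {in path_edges x v r, forall e, w e.1 (x e.2) = 1} \/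
    {in path_edges x v r, forall e, z e.1 (x e.2) = 1}) ->
  (forall v, exists2 g, act (base V) g = v & zfree x z (base V) g) ->
  (forall a, exists g,
    [/\ act (base V) g = base V, zfree x z (base V) g & w (base V) g = a]) ->
  alpha != 1 -> w v1 (x l1) = 1 -> w v2 (x l2) = 1 ->
  z v1 (x l1) != 1 -> z v2 (x l2) != 1 -> z v1 (x l1) != z v2 (x l2) ->
  large G.
Proof.
move=> presG wc zc disj conn loops alpha1 w1 w2 z1 z2 z12.
pose X a b : free2 := if a == alpha then
  (if b == z v1 (x l1) then gen2 true else if b == z v2 (x l2) then gen2 false else 1) else 1.
have [Psi Psic [Psizf Psiw]] := disjoint_cocycle presG wc zc disj X.
set W := skew _ in Psi Psic Psizf Psiw.
exists (stab W); first exact: finite_index_stab.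
have psiM : {morph (fun h : subgroup (stab W) => Psi (base W) (val h)) : g h / g * h}.
  by move=> g h /=; rewrite Psic; have /stabE -> := valP g.
exists free2, (hom_of psiM); split; [exact: free2_free | exact: free2_non_abelian |].
apply: free2_surj => i.
pose v := if i then v1 else v2; pose l := if i then l1 else l2.
have wvl : w v (x l) = 1 by rewrite /v /l; case: i {v l}.
have zvl : z v (x l) != 1 by rewrite /v /l; case: i {v l wvl}.
have X1b b : X 1 b = 1 by rewrite /X eq_sym (negPf alpha1).
have Xa1 : X alpha 1 = 1 by rewrite /X eqxx ![1 == _]eq_sym (negPf z1) (negPf z2).
have Xaz : X alpha (z v (x l)) = gen2 i.
  by rewrite /X eqxx /v /l; case: i {v l wvl zvl}; rewrite ?eqxx// eq_sym (negPf z12).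
have [g gP] := loop_along_edge conn loops Psic Psizf Psiw wvl.
have [D [Db Dzf Dw]] := loops alpha.
have actD b : act ((base V, (1, b)) : W) D = (base V, (alpha, b)).
  by rewrite (zfree_act _ _ Dzf) Db Dw mul1g.
have PsiD b : Psi (base V, (1, b)) D = X alpha b.
  by rewrite Psizf// Dw mul1g X1b invg1 mul1g.
(* k runs around the rectangle (1, 1), (alpha, 1), (alpha, z), (1, z). *)
pose k := D * g * D^-1 * g^-1.
have actDg : act (base W) (D * g) = (base V, (alpha, z v (x l))).
  by rewrite actM actD (gP _ _).1 mul1g.
have actDgD : act (base W) (D * g * D^-1) = (base V, (1, z v (x l))).
  by rewrite actM actDg -actD actK.
have actg : act (base W) g = (base V, (1, z v (x l))).
  by rewrite (gP _ _).1 mul1g.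
have kb : act (base W) k = base W by rewrite /k actM actDgD -actg actK.
have Psik : Psi (base W) k = (gen2 i)^-1.
  rewrite /k Psic actDgD -actg cocycleV// (gP _ _).2 invg1 mulg1.
  rewrite Psic actDg -actD cocycleV// PsiD Xaz Psic actD (gP _ _).2 mulg1.
  by rewrite -[base W]/((base V, (1, 1)) : W) PsiD Xa1 mul1g.
have kS : k \in stab W by exact/stabE.
exists (Sub k kS)^-1; rewrite gmulfV /=.
by rewrite Psik invgK.
Qed.

(** * A cocycle of small support makes the group large *)

Section ThinLarge.
Variables (G : groupType) (L : finType) (x : L -> G) (V : gset G) (p d : nat).
Hypotheses (genG : word_generated x) (tV : transitive_gset V) (pp : prime p).
Variable u : V -> G -> 'rV['F_p]_d.
Hypotheses (uc : cocycle u) (ul : onto_loops u).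

(** The cocycles t.u + d phi form a space of dimension d + |V| - 1, because no nonzero
    combination of the components of u is a coboundary. So fewer conditions than that
    leave a nonzero cocycle. *)
Lemma cocycle_vanishing (S : seq (V * L)) : (size S + 1 < d + #|V|)%N ->
  exists z : V -> G -> 'F_p, [/\ cocycle z, {in S, forall e, z e.1 (x e.2) = 0%R} &
    exists v l, z v (x l) != 0%R].
Proof.
move=> hS; pose z (tf : 'cV['F_p]_d * {ffun V -> 'F_p}) v g : 'F_p :=
  ((u v g *m tf.1) 0 0 + tf.2 (act v g) - tf.2 v)%R.
have zc tf : cocycle (z tf).
  move=> v g h; rewrite -[RHS]/(z tf v g + z tf (act v g) h)%R /z (cocycleD uc) actM.
  rewrite mulmxDl mxE; ring.
have zB tf tf' v g : z (tf.1 - tf'.1, tf.2 - tf'.2)%R v g = (z tf v g - z tf' v g)%R.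
  by rewrite /z /= mulmxBr !mxE !ffunE; ring.
(* The first entry fixes the constant by which phi can be changed without changing d phi. *)
pose F (tf : 'cV['F_p]_d * {ffun V -> 'F_p}) : (size S).+1.-tuple 'F_p :=
  [tuple of tf.2 (base V) :: map_tuple (fun e => z tf e.1 (x e.2)) (in_tuple S)].
have : ~~ injectiveb F.
  apply/negP => /injectiveP/leq_card; rewrite card_tuple card_prod card_mx card_ffun card_Fp//.
  by rewrite muln1 -expnD leq_exp2l ?prime_gt1// leqNgt -addn1 hS.
case/injectivePn => tf [tf' ne] /(congr1 val) [eb eS].
pose s : 'cV['F_p]_d * {ffun V -> 'F_p} := (tf.1 - tf'.1, tf.2 - tf'.2)%R.
exists (z s); split=> // [e eS'|].
  rewrite zB; apply/eqP; rewrite subr_eq0; apply/eqP.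
  by move/eq_in_map: eS; apply.
apply: contrapT => no; have z0 v l : z s v (x l) = 0%R.
  by apply/eqP/negP => /negP nz; apply: no; exists v, l.
have z00 g : forall v, z s v g = 0%R.
  elim/genG: g => [v|g l IHg v]; first exact: cocycle1.
  by rewrite (cocycleD (zc s)) IHg z0 addr0.
have t0 : s.1 = 0%R.
  apply/colP=> i; rewrite [RHS]mxE; have [g gb gu] := ul (delta_mx ord0 i).
  by have := z00 g (base V); rewrite /z gb gu addrK -rowE mxE.
have f0 v : s.2 v = 0%R.
  have [g gv] := tV v; have := z00 g (base V).
  rewrite /z t0 mulmx0 mxE add0r gv => /eqP; rewrite subr_eq0 => /eqP ->.
  by rewrite /s /= !ffunE eb subrr.
case/negP: ne; apply/eqP; move: t0 f0; rewrite /s /= => /eqP; rewrite subr_eq0 => /eqP e1 f0.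
rewrite [tf]surjective_pairing [tf']surjective_pairing e1; congr (_, _).
by apply/ffunP=> v; move/eqP: (f0 v); rewrite !ffunE subr_eq0 => /eqP.
Qed.

Variable rs : seq (seq L).
Hypothesis presG : presents x rs.
Variable w : V -> G -> 'F_p.
Hypotheses (wc : cocycle w) (wl : exists2 g, act (base V) g = base V & w (base V) g != 0%R).

Let supp := enum [set e : V * L | w e.1 (x e.2) != 0%R]%SET.

(** The edges of a spanning tree cost |V| - 1 conditions, which is the dimension of the
    space of coboundaries. What is left of the d classes suffices for the edges of the
    2-cells that meet the support of w, and for one edge that closes up tree paths to a loop
    on which w is not zero. *)
Lemma thin_large : (((\sum_(r <- rs) size r ^ 2) + 1) * size supp + 2 < d)%N -> large G.
Proof.
move=> hd; set C := (\sum_(r <- rs) _)%N in hd.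
have suppE e : (e \in supp) = (w e.1 (x e.2) != 0%R) by rewrite mem_enum inE.
have connA (A : {set V}) : base V \in A ->
    (forall v l, v \in A -> act v (x l) \in A) -> A = [set: V]%SET.
  move=> bA cA; apply/setP => v; rewrite inE; have [g <-] := tV v.
  elim/genG: g => [|g l IHg]; first by rewrite act1.
  by rewrite actM; exact: cA.
have [T Tn /choice[tau tauP]] : exists2 T : {set V * L}, (#|T| < #|V|)%N &
    forall v, exists g, act (base V) g = v /\ tree_path x T g.
  by have [T Tn Tt] := spanning_tree connA; exists T => // v; have [g] := Tt v; exists g.
have tauv v : act (base V) (tau v) = v by case: (tauP v).
have [v' [l' wl']] : exists v l,
    (w (base V) (tau v) + w v (x l) != w (base V) (tau (act v (x l))))%R.
  apply: contrapT => no; have no' v l :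
      (w (base V) (tau v) + w v (x l) = w (base V) (tau (act v (x l))))%R.
    by apply/eqP/negP => /negP nz; apply: no; exists v, l.
  have ext g v : (w (base V) (tau v) + w v g = w (base V) (tau (act v g)))%R.
    elim/genG: g => [|g l IHg]; first by rewrite act1 cocycle1//; exact: addr0.
    by rewrite (cocycleD wc) addrA IHg no' actM.
  have [g gb gw] := wl; have := ext g (base V); rewrite gb => /eqP.
  by rewrite -[eqbRHS]addr0 (inj_eq (addrI _)) (negPf gw).
(* The last edge closes up the loop D below. *)
pose S1 := enum T ++ touched_edges x rs supp ++ supp ++ [:: (v', l')].
have sS1 : (size S1 < #|V| + C * size supp + size supp + 1)%N.
  have sT : (size (enum T) < #|V|)%N by rewrite -cardE.
  by rewrite !size_cat size_touched_edges -/C !addnA !ltn_add2r.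
have [h1 h2] : (size S1 + 1 < d + #|V|)%N /\ ((size S1).+1 + 1 < d + #|V|)%N.
  move: sS1 hd; move: (size S1) (size supp) #|V| => a s n; nia.
have [z1 [z1c z1S [v1 [l1 z1n]]]] := cocycle_vanishing h1.
(* As z2 vanishes where z1 does not, the two values of z differ. *)
have [z2 [z2c z2S [v2 [l2 z2n]]]] := @cocycle_vanishing ((v1, l1) :: S1) h2.
pose z v g : 'F_p * 'F_p := (z1 v g, z2 v g).
have zc : cocycle z by move=> v g h; rewrite /z z1c z2c.
have zS e : e \in S1 -> z e.1 (x e.2) = 1.
  by move=> eS; rewrite /z z1S// z2S// inE eS orbT.
have in1 : {subset T <= S1} by move=> e eT; rewrite mem_cat mem_enum eT.
have wz v l : z v (x l) != 1 -> w v (x l) = 0%R.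
  move=> zn; apply/eqP/negP => /negP; rewrite -(suppE (v, l)) => vs; move/negP: zn; apply.
  by apply/eqP; apply: (zS (v, l)); rewrite !mem_cat vs !orbT.
have zn1 : z v1 (x l1) != 1 by apply: contra z1n => /eqP[-> _].
have zn2 : z v2 (x l2) != 1 by apply: contra z2n => /eqP[_ ->].
have taufree v : zfree x z (base V) (tau v).
  have [_] := tauP v; apply=> [P P1 //|g l zg gT P P1 Pl PM PV].
  by apply: (PM); [exact: zg | apply: Pl; apply: (zS (_, _)); exact: in1].
have zfV v0 g : zfree x z v0 g -> zfree x z (act v0 g) g^-1.
  by move=> zf P P1 Pl PM PV; apply: (PV); exact: zf.
have zfM v0 g h : zfree x z v0 g -> zfree x z (act v0 g) h -> zfree x z v0 (g * h).
  by move=> zg zh P P1 Pl PM PV; apply: (PM); [exact: zg | exact: zh].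
pose D := tau v' * x l' * (tau (act v' (x l')))^-1.
have actD : act (base V) D = base V.
  by rewrite !actM tauv -{1}[act v' (x l')]tauv actK.
have zD : zfree x z (base V) D.
  apply: (zfM); first apply: (zfM); first exact: taufree.
    rewrite tauv => P P1 Pl PM PV; apply: Pl; apply: (zS (_, _)).
    by rewrite !mem_cat mem_head !orbT.
  by rewrite actM tauv -{1}[act v' (x l')]tauv; apply: zfV; exact: taufree.
pose om := w (base V) D.
have om0 : om != 0%R.
  have := cocycleV wc (base V) (tau (act v' (x l'))); rewrite tauv => eV.
  rewrite /om /D !(cocycleD wc) actM tauv eV.
  by rewrite -[X in (_ + X)%R]/(- w (base V) (tau (act v' (x l'))))%R subr_eq0.
apply: (@disjoint_large G L x rs V 'F_p ('F_p * 'F_p)%type w z (1%R : 'F_p) v1 l1 v2 l2)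
  => //.
- move=> r v rrs; have [no|yes] := touched_edgesP x supp v rrs; [left|right] => e er.
    by apply/eqP/negP => /negP; rewrite -suppE (negPf (no e er)).
  by apply: zS; rewrite !mem_cat yes ?orbT.
- by move=> v; exists (tau v).
(* A power of D has any prescribed monodromy, since om is not zero. *)
- move=> a; pose n : nat := (a / om)%R.
  have nE m : [/\ act (base V) (D ^+ m) = base V, zfree x z (base V) (D ^+ m) &
      w (base V) (D ^+ m) = (om *+ m)%R].
    elim: m => [|m [mb mz mw]].
      by split; [exact: act1 | by move=> P P1 | exact: cocycle1].
    rewrite expgS; split; first by rewrite actM actD.
      by apply: (zfM); rewrite ?actD.
    by rewrite (cocycleD wc) actD mw mulrS.
  exists (D ^+ n); have [nb nz nw] := nE n; split=> //.
  by rewrite nw -mulr_natl natr_Zp mulfVK.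
- exact: wz.
- exact: wz.
- apply/eqP => -[_ e2]; case/negP: z2n; rewrite -e2.
  by apply/eqP; apply: (z2S (v1, l1)); rewrite mem_head.
Qed.

End ThinLarge.

(** * Linear algebra over finite fields *)

Lemma card_rVp (p d : nat) : prime p -> #|('rV['F_p]_d : finType)| = (p ^ d)%N.
Proof. by move=> pp; rewrite card_mx card_Fp// mul1n. Qed.

(** Over a prime field an additively closed set is a subspace, and a proper subspace is
    killed by a nonzero linear form. *)
Lemma span_Fp (p m : nat) (I : 'rV['F_p]_m -> Prop) :
  I 0%R -> (forall a b, I a -> I b -> I (a + b)%R) ->
  (forall s : 'cV['F_p]_m, (forall y, I y -> (y *m s)%R = 0%R) -> s = 0%R) ->
  forall y, I y.
Proof.
move=> I0 ID Is y; pose S := [set y | `[< I y >]]%SET.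
pose A := (\matrix_(i < #|S|) enum_val i)%R.
have A0 : cokermx A = 0%R.
  apply/matrixP=> i j; rewrite [RHS]mxE.
  suff /colP/(_ i) : col j (cokermx A) = 0%R by rewrite !mxE.
  apply: Is => z Iz; have zS : z \in S by rewrite inE; exact/asboolP.
  have -> : z = row (enum_rank_in zS z) A by rewrite rowK enum_rankK_in.
  by rewrite colE mulmxA -row_mul mulmx_coker row0 mul0mx.
have /submxP[D ->] : (y <= A)%MS by rewrite submx_full// -cokermx_eq0 A0.
rewrite mulmx_sum_row; apply: big_ind => // i _; rewrite rowK.
rewrite -(natr_Zp (D 0%R i)) scaler_nat.
have Ii : I (enum_val i) by have := enum_valP i; rewrite inE => /asboolP.
by elim: (D _ _ : nat) => [|n IHn]; rewrite ?mulr0n// mulrS; exact: ID.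
Qed.

(** Each nonempty fibre of N is a translate of its kernel, and there are at most p^m of them. *)
Lemma card_kernel_Fp (p d m : nat) (N : 'M['F_p]_(d, m)) : prime p ->
  (p ^ d <= #|[set g : 'rV['F_p]_d | (g *m N)%R == 0%R]%SET| * p ^ m)%N.
Proof.
move=> pp; set K := [set _ | _]%SET.
pose sec (y : 'rV['F_p]_m) : 'rV['F_p]_d :=
  if [pick g : 'rV_d | (g *m N)%R == y] is Some g then g else 0%R.
have secP g : (sec (g *m N) *m N = g *m N)%R.
  by rewrite /sec; case: pickP => [h /eqP//|/(_ g)]; rewrite eqxx.
pose F g := (g - sec (g *m N)%R, g *m N)%R.
have Finj : injective F.
  move=> g h /eqP; rewrite /F xpair_eqE => /andP[/eqP + /eqP e].
  by rewrite e => /addIr.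
rewrite -(card_rVp d pp) -(card_imset _ Finj) -(card_rVp m pp) -cardsT -cardsX.
apply: subset_leq_card; apply/fintype.subsetP => _ /imsetP[g _ ->].
by rewrite !inE /= mulmxBl secP subrr eqxx.
Qed.

Lemma kernel_rows (F : fieldType) (N n m : nat) (A : 'M[F]_(N, n)) : (n + m <= N)%N ->
  exists B : 'M[F]_(m, N), row_free B /\ (B *m A = 0)%R.
Proof.
move=> nmN; have mk : (m <= \rank (kermx A))%N.
  rewrite mxrank_ker; have := rank_leq_col A; lia.
exists (pid_mx m *m row_base (kermx A))%R; split.
  by rewrite /row_free mxrankMfree ?row_base_free// rank_pid_mx.
rewrite -mulmxA; have /submxP[D ->] : (row_base (kermx A) <= kermx A)%MS by rewrite eq_row_base.
by rewrite -mulmxA mulmx_ker !mulmx0.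
Qed.

(** * Shrinking the supports of cocycles *)

Section Shrink.
Variables (G : groupType) (L : finType) (x : L -> G) (rs : seq (seq L)) (p : nat).
Hypotheses (presG : presents x rs) (genG : word_generated x) (pp : prime p).
Variables (V : gset G) (d m : nat) (u : V -> G -> 'rV['F_p]_d) (w : V -> G -> 'rV['F_p]_m).
Hypotheses (uc : cocycle u) (wc : cocycle w).

Local Notation W := (skew uc).

(** With g the coordinate in the fibre of the cover defined by u and y a value of w, this
    is the value of the cochain sum lam_ab f_a w_b, where f_a is the a-th coordinate of
    the fibre. *)
Definition twist (lam : 'M['F_p]_(d, m)) (g : 'rV['F_p]_d) (y : 'rV['F_p]_m) : 'F_p :=
  (g *m lam *m y^T)%R 0%R 0%R.

Lemma twistDl lam g h y : twist lam (g + h)%R y = (twist lam g y + twist lam h y)%R.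
Proof. by rewrite /twist !mulmxDl mxE. Qed.

Lemma twistDr lam g y z : twist lam g (y + z)%R = (twist lam g y + twist lam g z)%R.
Proof. by rewrite /twist linearD mulmxDr mxE. Qed.

Lemma twistP a lam mu g y :
  twist (a *: lam + mu)%R g y = (a * twist lam g y + twist mu g y)%R.
Proof. by rewrite /twist mulmxDr mulmxDl -scalemxAr -scalemxAl !mxE. Qed.

Lemma twist0l lam y : twist lam 0%R y = 0%R.
Proof. by rewrite /twist !mul0mx mxE. Qed.

Lemma twist0r lam g : twist lam g 0%R = 0%R.
Proof. by rewrite /twist trmx0 mulmx0 mxE. Qed.

Definition twist_val (lam : 'M['F_p]_(d, m)) (s : W) (r : seq L) : 'F_p :=
  path_val x (fun (s : W) l => twist lam s.2 (w s.1 (x l))) s r.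

(** Moving the starting point in the fibre changes the value around a closed path only by
    a multiple of the value of w. So around a relator the value depends only on the point
    of V below, and the twisted cochain is a cocycle under |rs| |V| conditions, a number
    that does not involve the size of the fibre. *)
Lemma twist_val_shift lam v g r :
  twist_val lam (v, g) r =
  (twist lam g (w v (\prod_(l <- r) x l)) + twist_val lam (v, 0%R) r)%R.
Proof.
elim: r v g => [|l r IHr] v g.
  have w1 : w v 1 = 0%R := cocycle1 wc v.
  by rewrite big_nil w1 twist0r add0r.
rewrite big_cons (cocycleD wc) twistDr.
rewrite -[LHS]/(twist lam g (w v (x l)) +
  twist_val lam (act v (x l), g + u v (x l))%R r)%R.
rewrite -[X in (_ = _ + X)%R]/(twist lam 0 (w v (x l)) +
  twist_val lam (act v (x l), 0 + u v (x l))%R r)%R.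
by rewrite IHr [in RHS]IHr twist0l !add0r twistDl !addrA.
Qed.

Lemma twist_val_linear a lam mu s r :
  twist_val (a *: lam + mu)%R s r = (a * twist_val lam s r + twist_val mu s r)%R.
Proof.
elim: r s => [|l r IHr] s; first by rewrite -[RHS]/(a * 0 + 0)%R mulr0 addr0.
rewrite -[LHS]/(twist (a *: lam + mu)%R s.2 (w s.1 (x l)) +
  twist_val (a *: lam + mu)%R (act s (x l)) r)%R.
rewrite -[RHS]/(a * (twist lam s.2 (w s.1 (x l)) + twist_val lam (act s (x l)) r) +
  (twist mu s.2 (w s.1 (x l)) + twist_val mu (act s (x l)) r))%R.
by rewrite twistP IHr; ring.
Qed.

(** The conditions on lam number |rs| |V| for closedness and m^2 for H lam = 0, which is
    the condition that keeps the classes independent in [shrink_support]. *)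
Lemma twist_kernel (H : 'M['F_p]_(m, d)) : (size rs * #|V| + m * m + m <= d * m)%N ->
  exists lam : 'I_m -> 'M['F_p]_(d, m),
    [/\ forall j r v, r \in rs -> twist_val (lam j) (v, 0%R) r = 0%R,
        forall j, (H *m lam j)%R = 0%R &
        forall a : 'I_m -> 'F_p, (\sum_j a j *: lam j = 0)%R -> forall j, a j = 0%R].
Proof.
move=> hdm.
pose f (lam : 'M['F_p]_(d, m)) : 'M['F_p]_(size rs, #|V|) :=
  (\matrix_(i, j) twist_val lam (enum_val j, 0%R) (nth [::] rs i))%R.
have flin : linear f by move=> a lam mu; apply/matrixP=> i j; rewrite /f !mxE twist_val_linear.
pose fL : {linear 'M['F_p]_(d, m) -> 'M['F_p]_(size rs, #|V|)} :=
  HB.pack f (GRing.isLinear.Build _ _ _ _ f flin).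
have [B [Bfree]] := @kernel_rows _ _ _ m (row_mx (lin_mx fL) (lin_mulmx H)) hdm.
rewrite mul_mx_row -(row_mx0 _ _ (size rs * #|V|)) => /eq_row_mx[B1 B2].
exists (fun j => vec_mx (row j B)); split=> [j r v rrs|j|a a0 j].
- have : f (vec_mx (row j B)) = 0%R.
    by apply: (can_inj mxvecK); rewrite -(mul_vec_lin fL) vec_mxK -row_mul B1 row0 linear0.
  have ir : (index r rs < size rs)%N by rewrite index_mem.
  by move/matrixP/(_ (Ordinal ir) (enum_rank v)); rewrite /f !mxE enum_rankK nth_index.
- apply: (can_inj mxvecK); rewrite -(mul_vec_lin (mulmx H)) vec_mxK -row_mul B2 row0.
  by rewrite linear0.
- have : ((\row_j a j) *m B)%R = 0%R.
    rewrite mulmx_sum_row; apply: (can_inj vec_mxK); rewrite linear_sum linear0 -[RHS]a0.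
    by apply: eq_bigr => k _; rewrite linearZ mxE.
  rewrite -(mul0mx _ B) => /(row_free_inj Bfree)/rowP/(_ j).
  by rewrite !mxE.
Qed.

Definition support (X : gset G) n (f : X -> G -> 'rV['F_p]_n) : {set X * L} :=
  [set e | f e.1 (x e.2) != 0%R]%SET.

(** Over an edge where w is nonzero, w' is a linear function of the fibre coordinate, so
    it vanishes on a proportion at least p^-m of the fibre. *)
Lemma card_support_skew (w' : W -> G -> 'rV['F_p]_m) (N : V -> L -> 'M['F_p]_(d, m)) :
  (forall v g l, w' (v, g) (x l) = (g *m N v l)%R) ->
  (forall v l, w v (x l) = 0%R -> N v l = 0%R) ->
  (#|support w'| * p ^ m <= (p ^ m - 1) * p ^ d * #|support w|)%N.
Proof.
move=> w'E Nw.
have fibre v l : (\sum_(g : 'rV['F_p]_d) (w' (v, g) (x l) != 0%R) * p ^ m <=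
    (p ^ m - 1) * p ^ d * (w v (x l) != 0%R))%N.
  have [w0|w0] /= := eqVneq (w v (x l)) 0%R.
    rewrite muln0 big1// => g _; by rewrite w'E Nw// mulmx0 eqxx.
  rewrite muln1 -big_distrl /=.
  have := card_kernel_Fp (N v l) pp; set K := [set _ | _]%SET.
  have -> : (\sum_(g : 'rV['F_p]_d) (w' (v, g) (x l) != 0%R) = #|~: K|)%N.
    rewrite -sum1_card [RHS]big_mkcond /=; apply: eq_bigr => g _.
    by rewrite !inE w'E; case: (_ == _).
  have := cardsC K; rewrite card_rVp// => <-.
  have : (0 < p ^ m)%N by rewrite expn_gt0 prime_gt0.
  move: #|_| #|_| (p ^ m)%N => a b q; nia.
pose b (s : W) l : nat := (w' s (x l) != 0%R).
have -> : #|support w'| = (\sum_(v : V) \sum_(l : L) \sum_(g : 'rV['F_p]_d) b (v, g) l)%N.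
  transitivity (\sum_(s : W) \sum_(l : L) b s l)%N.
    rewrite [RHS]pair_bigA /= -sum1_card [LHS]big_mkcond /=; apply: eq_bigr => t _.
    by rewrite inE /b; case: (_ != _).
  transitivity (\sum_(v : V) \sum_(g : 'rV['F_p]_d) \sum_(l : L) b (v, g) l)%N.
    by rewrite [RHS]pair_bigA; apply: eq_bigr => -[].
  by apply: eq_bigr => v _; rewrite exchange_big.
have -> : #|support w| = (\sum_(v : V) \sum_(l : L) (w v (x l) != 0%R))%N.
  rewrite [RHS]pair_bigA /= -sum1_card [LHS]big_mkcond /=; apply: eq_bigr => t _.
  by rewrite inE; case: (_ != _).
rewrite big_distrl big_distrr /=; apply: leq_sum => v _.
rewrite big_distrl big_distrr /=; apply: leq_sum => l _.
by rewrite big_distrl; exact: fibre.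
Qed.

Hypotheses (ul : onto_loops u) (wl : onto_loops w).

(** The classes stay independent for the following reason. Let h_j be loops with
    w (h_j) = e_j, and impose u (h_j) lam = 0 for all j. If the cochain of such a lam
    vanishes on all loops, comparing the paths g h and h g gives
    u (g) lam w (h) = u (h) lam w (g) for all loops g and h of V. For h = h_j this reads
    u (g) lam e_j = 0, so lam = 0 since the u (g) fill the whole space. *)
Lemma shrink_support : (size rs * #|V| + m * m + m <= d * m)%N ->
  exists w' : W -> G -> 'rV['F_p]_m, [/\ cocycle w', onto_loops w' &
    (#|support w'| * p ^ m <= (p ^ m - 1) * p ^ d * #|support w|)%N].
Proof.
move=> hdm.
have /choice[h hP] (j : 'I_m) : exists g, act (base V) g = base V /\
    w (base V) g = delta_mx ord0 j.
  by have [g gb gw] := wl (delta_mx ord0 j); exists g.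
pose H : 'M['F_p]_(m, d) := (\matrix_j u (base V) (h j))%R.
have [lam [lamr lamH lamfree]] := twist_kernel H hdm.
pose T g y : 'rV['F_p]_m := (\row_j twist (lam j) g y)%R.
have TDl g1 g2 y : T (g1 + g2)%R y = (T g1 y + T g2 y)%R.
  by apply/rowP=> j; rewrite !mxE twistDl.
have TDr g y1 y2 : T g (y1 + y2)%R = (T g y1 + T g y2)%R.
  by apply/rowP=> j; rewrite !mxE twistDr.
have T0r g : T g 0%R = 0%R by apply/rowP=> j; rewrite !mxE twist0r.
have T0l y : T 0%R y = 0%R by apply/rowP=> j; rewrite !mxE twist0l.
have w1 v : w v 1 = 0%R := cocycle1 wc v.
pose c (s : W) l := T s.2 (w s.1 (x l)).
have pathE s r j : path_val x c s r 0%R j = twist_val (lam j) s r.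
  elim: r s => [|l r IHr] s; first by rewrite [LHS]mxE.
  rewrite -[path_val _ _ _ _]/(T s.2 (w s.1 (x l)) + path_val x c (act s (x l)) r)%R.
  by rewrite !mxE IHr.
have [r [v g] rrs|w' w'c w'E] := @extend_cocycle _ _ x rs W _ c presG.
  apply/rowP=> j; rewrite pathE twist_val_shift// (presG.1 _ rrs) w1 twist0r add0r lamr//.
  by rewrite [RHS]mxE.
have shift g : forall v a, w' (v, a) g = (T a (w v g) + w' (v, 0%R) g)%R.
  elim/genG: g => [|g l IHg] v a.
    have w'1 s : w' s 1 = 0%R := cocycle1 w'c s.
    by rewrite !w'1 w1 T0r addr0.
  rewrite !(cocycleD w'c) !w'E (cocycleD wc) TDr /c.
  rewrite [in LHS]IHg !act_skewD /= add0r TDl -!addrA; congr (_ + _)%R.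
  by rewrite addrCA.
have loopM g g' : act (base V) g = base V -> act (base V) g' = base V ->
    act (base W) (g * g') = (base V, u (base V) g + u (base V) g')%R.
  by move=> gb gb'; rewrite base_skewD actM (act_skewD uc (base V) 0%R) gb act_skewD gb' add0r.
exists w'; split=> //; last first.
  apply: (@card_support_skew _ (fun v l => \matrix_(i, j) (lam j *m (w v (x l))^T) i 0)%R).
    move=> v g l; rewrite w'E /c /=; apply/rowP=> j.
    rewrite [LHS]mxE [RHS]mxE /twist -mulmxA [LHS]mxE.
    by apply: eq_bigr => i _; rewrite [in RHS]mxE.
  by move=> v l wv0; apply/matrixP=> i j; rewrite mxE wv0 trmx0 mulmx0 !mxE.
pose I y := exists g, act (base W) g = base W /\ w' (base W) g = y.
suff allI y : I y by move=> y; have [g [gb gw]] := allI y; exists g.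
apply: span_Fp => [|a b [g [gb <-]] [g' [gb' <-]]|s sI] {y}.
- by exists 1; split; [exact: act1 | exact: cocycle1].
- exists (g * g'); split; first by rewrite actM gb.
  by rewrite (cocycleD w'c) gb.
have comm g g' : act (base V) g = base V -> act (base V) g' = base V ->
    (T (u (base V) g) (w (base V) g') *m s = T (u (base V) g') (w (base V) g) *m s)%R.
  move=> gb gb'.
  have [k kb ku] := ul (- (u (base V) g + u (base V) g'))%R.
  (* The loop k closes up both g g' and g' g in the cover. *)
  have key a b : act (base V) a = base V -> act (base V) b = base V ->
      (u (base V) a + u (base V) b = u (base V) g + u (base V) g')%R ->
      ((w' (base W) a + w' (base W) b + T (u (base V) a) (w (base V) b)) *m s =
        - (w' (base V, u (base V) g + u (base V) g') k *m s))%R.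
    move=> ab bb uab; apply/eqP; rewrite -addr_eq0 -mulmxDl; apply/eqP.
    apply: sI; exists (a * b * k); split.
      by rewrite actM loopM// uab act_skewD kb ku subrr.
    rewrite (cocycleD w'c) loopM// uab (cocycleD w'c); congr (_ + _)%R.
    rewrite -addrA; congr (_ + _)%R.
    by rewrite base_skewD act_skewD ab add0r shift addrC.
  have := key g g' gb gb' erefl.
  rewrite -(key g' g gb' gb (addrC _ _)) !mulmxDl => /eqP.
  by rewrite [X in _ == (X + _)%R]addrC (inj_eq (addrI _)) => /eqP.
pose lams := (\sum_j s j 0%R *: lam j)%R.
have Ts g y : (T g y *m s)%R = (twist lams g y)%:M%R.
  apply/matrixP=> i j; rewrite !ord1 !mxE eqxx mulr1n /twist /lams.
  rewrite mulmx_sumr mulmx_suml summxE; apply: eq_bigr => k _.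
  by rewrite mxE -scalemxAr -scalemxAl mxE mulrC.
suff lams0 : lams = 0%R.
  by apply/colP => j; rewrite [RHS]mxE; apply: (lamfree (fun j => s j 0%R)).
apply/matrixP=> i j; rewrite [RHS]mxE.
have [g gb gu] := ul (delta_mx ord0 i); have [hb hw] := hP j.
have := comm g (h j) gb hb; rewrite !Ts gu hw.
have Hlams : (H *m lams = 0)%R.
  by rewrite mulmx_sumr big1// => k _; rewrite -scalemxAr lamH scaler0.
have -> : twist lams (u (base V) (h j)) (w (base V) g) = 0%R.
  rewrite /twist; have -> : u (base V) (h j) = row j H by rewrite rowK.
  by rewrite -row_mul Hlams row0 mul0mx mxE.
move/matrixP/(_ 0%R 0%R); rewrite !mxE eqxx !mulr1n => <-.
by rewrite /twist -rowE trmx_delta -colE !mxE.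
Qed.

End Shrink.

(** * The first homology of an elementary abelian quotient *)

Local Open Scope ring_scope.

Local Notation delta1 z := [freeg [:: (1, z)]].

Section FreegLift.
Variables (R : nzRingType) (K : choiceType) (M : lmodType R) (f : K -> M).

Lemma freegU_scale (c : R) (z : K) : [freeg [:: (c, z)]] = c *: (delta1 z) :> {freeg K / R}.
Proof. by apply/eqP/freeg_eqP => y; rewrite coeffZ !coeffU mul1r. Qed.

Lemma fglift_linear : linear (fglift f : {freeg K / R} -> M).
Proof.
have addL : additive (fglift f : {freeg K / R} -> M) := lift_is_additive f.
have add0 : fglift f (0 : {freeg K / R}) = 0 by rewrite -[0]subr0 addL subrr.
have addD D E : fglift f (D + E) = fglift f D + fglift f E.
  by rewrite -{1}[E]opprK addL -[- E]add0r addL add0 add0r opprK.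
have addS I (r : seq I) (F : I -> {freeg K / R}) :
    fglift f (\sum_(i <- r) F i) = \sum_(i <- r) fglift f (F i).
  by elim: r => [|i r IHr]; rewrite ?big_nil// !big_cons addD IHr.
move=> c D E; rewrite addD; congr (_ + _).
rewrite -[c *: D]/(\sum_(z <- dom D) [freeg [:: (c * coeff z D, z)]]).
rewrite -{3}[D]freeg_sumE !addS scaler_sumr; apply: eq_bigr => z _.
by rewrite !liftU scalerA.
Qed.

Definition freeg_lift : {linear {freeg K / R} -> M} :=
  HB.pack (fglift f) (GRing.isLinear.Build R _ M _ (fglift f) fglift_linear).

Lemma freeg_liftU z : freeg_lift (delta1 z) = f z.
Proof. by rewrite [LHS]liftU scale1r. Qed.
End FreegLift.

Section KernelClosed.
Variables (R : nzRingType) (U V : lmodType R) (phi : {linear U -> V}).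

Definition kernel_pred : {pred U} := fun v => phi v == 0.

Let kernel_subsemimod : GRing.subsemimod_closed kernel_pred.
Proof.
split; first split; rewrite ?inE.
- by rewrite unfold_in linear0.
- by move=> v w /eqP v0 /eqP w0; rewrite unfold_in linearD v0 w0 addr0.
- by move=> c v /eqP v0; rewrite unfold_in linearZZ v0 scaler0.
Qed.

Definition kernel_closed : submodClosed U :=
  HB.pack kernel_pred (GRing.isSubSemiModClosed.Build R U kernel_pred kernel_subsemimod).

Lemma kernel_closedE v : (v \in kernel_closed) = (phi v == 0).
Proof. by []. Qed.
End KernelClosed.

Section ElementaryAbelian.
Variables (p : nat) (Q : groupType) (pp : prime p) (eQ : elementary_abelian p Q).

(** The group Q written additively, with scalars acting by powers. *)
Definition vector_of of prime p & elementary_abelian p Q : Type := Q.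
Notation M := (vector_of pp eQ).
HB.instance Definition _ := Choice.copy M Q.
Let mulC : commutative (fun a b : M => (a * b)%g : M). Proof. exact: eQ.1. Qed.
HB.instance Definition _ := GRing.isZmodule.Build M (@mulgA Q) mulC (@mul1g Q) (@mulVg Q).

Let scale (a : 'F_p) (q : M) : M := (q ^+ a)%g.

Let expMod (q : Q) n : (q ^+ (n %% (Zp_trunc (pdiv p)).+2) = q ^+ n)%g.
Proof. by rewrite Fp_cast// {2}(divn_eq n p) expgnDr mulnC expgnA eQ.2 expg1n mul1g. Qed.

Let scaleA a b q : scale a (scale b q) = scale (a * b) q.
Proof. by rewrite /scale /= expMod mulnC -expgnA. Qed.
Let scale1 : left_id 1 scale.
Proof. by move=> q; rewrite /scale /= expMod expg1. Qed.
Let scaleDr : right_distributive scale +%R.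
Proof. by move=> a q r; apply: expgMn; exact: eQ.1. Qed.
Let scaleDl q : {morph scale^~ q : a b / a + b}.
Proof. by move=> a b; rewrite /scale /= expMod expgnDr. Qed.
HB.instance Definition _ := GRing.Zmodule_isLmodule.Build 'F_p M scaleA scale1 scaleDr scaleDl.

(** The linear map from chains to Q that sends the generator of q to q itself kills the
    boundaries. *)
Lemma boundaries1_one (q : Q) : boundaries1 (delta1 q : chain1 p Q) -> q = 1%g.
Proof.
pose psi := freeg_lift (fun q : Q => q : M) : {linear chain1 p Q -> M}.
move=> /(_ (kernel_closed psi)) H.
have : (delta1 q) \in kernel_closed psi.
  apply: H => y z; rewrite kernel_closedE linearD linearB /psi !freeg_liftU.
  by rewrite addrAC subr_eq0; apply/eqP; exact: (addrC (z : M) (y : M)).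
by rewrite kernel_closedE /psi freeg_liftU => /eqP.
Qed.

End ElementaryAbelian.

Lemma addr_insert (M : zmodType) (a b c d : M) : a + b - c = (a + d - c) + (b - d).
Proof. by rewrite [a + d - c]addrAC -[RHS]addrA [d + _]addrC subrK addrAC. Qed.

Lemma addr_insert2 (M : zmodType) (a b c d e : M) :
  a + d - c = (a - b) + (d - e) + (b + e - c).
Proof. by rewrite [a - b + _]addrACA -opprD [RHS]addrA addrNK. Qed.

Section Quotients.
Variables (K : groupType) (N N' : groupClosed K) (p : nat).
Hypothesis pp : prime p.
Notation Q := (quotient_group N N').

Section DimToHom.
Hypotheses (nN : normal_in N' N) (eQ : elementary_abelian p Q).

Lemma mem_is_coset g : g \in N -> `[< is_coset N N' (lcoset g N') >].
Proof. by move=> gN; apply/asboolP; exists g; split=> //; exact: nN.2. Qed.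

Let cos (g : K) : Q := insubd (1%g : Q) (lcoset g N').

Let val_cos g : g \in N -> val (cos g) = lcoset g N'.
Proof. by move=> gN; rewrite insubdK//; exact: mem_is_coset. Qed.

Let cosM g h : g \in N -> h \in N -> cos (g * h)%g = (cos g * cos h)%g.
Proof.
move=> gN hN; apply: val_inj; rewrite val_cos ?gpredM//=.
by rewrite !val_cos// lcosetM//; exact: nN.2.
Qed.

Let cos1 : cos 1%g = 1%g.
Proof. by apply: val_inj; rewrite val_cos// gpred1. Qed.

(** A positive value of [dim_H1] comes from a linear map phi on chains whose kernel
    consists of the boundaries. The map th is phi on generators: it is additive because
    phi kills boundaries, onto because its image spans, and its kernel is N' by
    [boundaries1_one]. *)
Lemma dim_H1_hom d : dim_H1 p Q = d -> (0 < d)%N ->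
  exists th : K -> 'rV['F_p]_d,
    [/\ {in N &, forall g h, th (g * h)%g = th g + th h},
        forall y, exists2 g, g \in N & th g = y &
        {in N, forall g, (th g == 0) = (g \in N')}].
Proof.
move=> dE d0; have [phi phis phik] : quotient_dim (@boundaries1 p Q) d.
  move: d0; rewrite -dE /dim_H1.
  by case: (xgetP 0%N [set d | quotient_dim (@boundaries1 p Q) d]) => [n _ //|].
have phiM x y : phi (delta1 (x * y)%g) = phi (delta1 x) + phi (delta1 y).
  have : phi (bar_boundary p x y) = 0.
    have : boundaries1 (bar_boundary p x y) by move=> S SP; exact: SP.
    by rewrite -phik.
  by rewrite linearD linearB => /eqP; rewrite addrAC subr_eq0 addrC => /eqP.
have phi1 : phi (delta1 (1%g : Q)) = 0.
  by apply: (addrI (phi (delta1 (1%g : Q)))); rewrite -phiM mulg1 addr0.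
exists (fun g => phi (delta1 (cos g))); split.
- by move=> g h gN hN; rewrite cosM.
- apply: span_Fp => [|_ _ [g gN <-] [h hN <-]|s sI].
  + exists 1%g; first exact: gpred1.
    by rewrite cos1.
  + by exists (g * h)%g; rewrite ?gpredM// cosM.
  + have cosE (q : Q) : exists2 g, g \in N & cos g = q.
      have [g [gN _ gq]] := quotientP q; exists g => //.
      by apply: val_inj; rewrite val_cos.
    have sphi v : (phi v *m s = 0)%R.
      rewrite -[v]freeg_sumE linear_sum mulmx_suml big1// => q _.
      rewrite freegU_scale linearZZ -scalemxAl; have [g gN <-] := cosE q.
      by rewrite sI ?scaler0//; exists g.
    apply/colP=> i; rewrite [RHS]mxE; have [v vi] := phis (delta_mx 0 i).
    have := sphi v; rewrite vi -rowE => /rowP/(_ 0).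
    by rewrite !mxE.
- move=> g gN; apply/eqP/idP => [g0|gN'].
    have /(boundaries1_one pp eQ) : boundaries1 (delta1 (cos g) : chain1 p Q) by rewrite -phik.
    move/(congr1 val); rewrite val_cos//= => /seteqP[/(_ g) H _].
    have /mem_lcoset : lcoset 1%g N' g by apply: H; apply/mem_lcoset; rewrite mulVg gpred1.
    by rewrite invg1 mul1g.
  suff -> : cos g = 1%g by [].
  apply: val_inj; rewrite val_cos//=; apply/seteqP.
  by split=> h /mem_lcoset hN; apply/mem_lcoset; move: hN;
    rewrite invg1 mul1g gpredMl ?gpredV.
Qed.

End DimToHom.

Section HomToDim.
Variables (d : nat) (th : K -> 'rV['F_p]_d).
Hypotheses (thM : {in N &, forall g h, th (g * h)%g = th g + th h})
  (ths : forall y, exists2 g, g \in N & th g = y)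
  (thk : forall g, (g \in N') = (g \in N) && (th g == 0)).

Let th1 : th 1%g = 0.
Proof. by apply: (addrI (th 1%g)); rewrite -thM ?gpred1// mulg1 addr0. Qed.

Let thV g : g \in N -> th g^-1%g = - th g.
Proof.
by move=> gN; apply: (addrI (th g)); rewrite -thM ?gpredV// mulgV th1 subrr.
Qed.

Lemma hom_normal_in : normal_in N' N.
Proof.
split=> [g|g gN y]; first by rewrite thk => /andP[].
have step h : h \in N -> forall y, y \in N' -> (y ^ h)%g \in N'.
  move=> hN z; rewrite !thk => /andP[zN /eqP z0]; rewrite gpredJ//=.
  by rewrite /conjg !thM ?(gpredV, gpredM)// z0 thV// add0r addNr.
apply/idP/idP => [yg|]; last exact: step.
by rewrite -[y](conjgK g); apply: step; rewrite ?gpredV.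
Qed.

Let rep (q : Q) : {g | g \in N & val q = lcoset g N'}.
Proof. by apply: cid2; have [g [gN _ gq]] := quotientP q; exists g. Qed.

Let thq (q : Q) : 'rV['F_p]_d := th (s2val (rep q)).

Let thqE q g : g \in N -> val q = lcoset g N' -> thq q = th g.
Proof.
move=> gN; rewrite /thq; case: (rep q) => /= h hN -> /seteqP[_ /(_ g)].
have gg : lcoset g N' g by apply/mem_lcoset; rewrite mulVg gpred1.
move=> /(_ gg)/mem_lcoset; rewrite thk thM ?gpredV// thV// => /andP[_].
by rewrite addrC subr_eq0 => /eqP.
Qed.

Let thqM q r : thq (q * r)%g = thq q + thq r.
Proof.
rewrite {2 3}/thq; case: (rep q) => /= g gN gq; case: (rep r) => /= h hN hr.
rewrite -thM//; apply: thqE; first exact: gpredM.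
rewrite -[LHS]/(mul_set (quotient_val q) (quotient_val r)) gq hr lcosetM//.
exact: hom_normal_in.2.
Qed.

Let thq_inj q : thq q = 0 -> q = 1%g.
Proof.
rewrite /thq; case: (rep q) => /= g gN gq g0; apply: val_inj; rewrite /= gq.
have gN' : g \in N' by rewrite thk gN g0 eqxx.
apply/seteqP.
by split=> h /mem_lcoset hN; apply/mem_lcoset; move: hN;
  rewrite invg1 mul1g gpredMl ?gpredV.
Qed.

Let thq1 : thq 1%g = 0.
Proof. by apply: (addrI (thq 1%g)); rewrite -thqM mulg1 addr0. Qed.

Let thqX q n : thq (q ^+ n)%g = thq q *+ n.
Proof. by elim: n => [|n IHn]; rewrite ?expg0// expgS thqM IHn mulrS. Qed.

Let thqV q : thq q^-1%g = - thq q.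
Proof. by apply: (addrI (thq q)); rewrite -thqM mulgV thq1 subrr. Qed.

Lemma hom_elementary_abelian : elementary_abelian p Q.
Proof.
split=> [q r|q].
  by apply: divg1_eq; apply: thq_inj; rewrite thqM thqV !thqM [thq r + _]addrC subrr.
by apply: thq_inj; rewrite thqX -scaler_nat pchar_Fp_0// scale0r.
Qed.

Let phi : {linear chain1 p Q -> 'rV['F_p]_d} := freeg_lift thq.

Let phi_boundaries : [set D | phi D = 0] = @boundaries1 p Q.
Proof.
apply/seteqP; split=> D /=; last first.
  move=> /(_ (kernel_closed phi)); rewrite kernel_closedE => H; apply/eqP; apply: H.
  move=> q r; rewrite kernel_closedE linearD linearB /phi !freeg_liftU thqM.
  by rewrite addrAC [thq r + _]addrC subrr.
move=> phiD S SP.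
have SN v : v \in S -> - v \in S by move=> vS; rewrite -scaleN1r; exact: rpredZ.
have SM (q r : Q) : delta1 q + delta1 r - delta1 (q * r)%g \in S.
  by rewrite -addrA addrC; exact: SP.
have S1 : delta1 (1%g : Q) \in S.
  by have := SP 1%g 1%g; rewrite /bar_boundary mulg1 subrr add0r.
have SX (q : Q) n : (n%:R *: delta1 q) - delta1 (q ^+ n)%g \in S.
  elim: n => [|n IHn]; first by rewrite scale0r expg0 add0r; exact: SN.
  rewrite -add1n natrD scalerDl scale1r expgS.
  have -> : delta1 q + n%:R *: delta1 q - delta1 (q * q ^+ n)%g =
      (delta1 q + delta1 (q ^+ n)%g - delta1 (q * q ^+ n)%g) +
      (n%:R *: delta1 q - delta1 (q ^+ n)%g) :> chain1 p Q.
    exact: addr_insert.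
  exact: rpredD.
have [q [qS phiq]] : exists q : Q, D - delta1 q \in S /\ phi D = thq q.
  rewrite -[D]freeg_sumE; elim: (dom D) => [|z s [q [IHs phis]]].
    by exists 1%g; rewrite big_nil add0r linear0; split; [exact: SN | rewrite thq1].
  rewrite big_cons freegU_scale; set a : 'F_p := coeff z D.
  exists ((z ^+ a) * q)%g; rewrite -{1}(natr_Zp a).
  move: IHs phis; set E := (\sum_(i <- s) _) => IHs phis; split; last first.
    by rewrite linearD linearZZ phis /phi freeg_liftU thqM thqX -scaler_nat natr_Zp.
  have -> : (a : nat)%:R *: delta1 z + E - delta1 (z ^+ a * q)%g =
     ((a : nat)%:R *: delta1 z - delta1 (z ^+ a)%g) + (E - delta1 q) +
     (delta1 (z ^+ a)%g + delta1 q - delta1 (z ^+ a * q)%g) :> chain1 p Q.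
    exact: addr_insert2.
  by apply: rpredD; [apply: rpredD; [exact: SX|] | exact: SM].
suff q1 : q = 1%g by rewrite -[D](subrK (delta1 q)) q1 rpredD// -q1.
by apply: thq_inj; rewrite -phiq.
Qed.

(** The extension of th to chains kills exactly the boundaries. Modulo boundaries a chain
    is equivalent to a single generator, so it is a boundary when its image is zero. *)
Lemma hom_dim_H1 : dim_H1 p Q = d.
Proof.
have surj_phi y : exists v, phi v = y.
  have [g gN gy] := ths y; exists (delta1 (insubd (1%g : Q) (lcoset g N'))).
  rewrite /phi freeg_liftU -gy; apply: thqE => //; rewrite insubdK//.
  by apply/asboolP; exists g; split=> //; exact: hom_normal_in.2.
apply: xget_unique; first by exists phi; [exact: surj_phi | exact: phi_boundaries].
have le_dim (d1 d2 : nat) (f1 : {linear chain1 p Q -> 'rV['F_p]_d1})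
    (f2 : {linear chain1 p Q -> 'rV['F_p]_d2}) :
    (forall y, exists v, f1 v = y) -> (forall v, f2 v = 0 -> f1 v = 0) -> (d1 <= d2)%N.
  move=> f1s f21; have /choice[v vE] (i : 'I_d1) := f1s (delta_mx 0 i).
  pose A := (\matrix_i f2 (v i))%R.
  have : row_free A.
    apply: inj_row_free => y; rewrite mulmx_sum_row => yA.
    have f2y : f2 (\sum_i y 0 i *: v i) = 0.
      by rewrite linear_sum -[RHS]yA; apply: eq_bigr => i _; rewrite linearZZ rowK.
    have := f21 _ f2y; rewrite linear_sum => e; rewrite -[RHS]e [LHS]row_sum_delta.
    by apply: eq_bigr => i _; rewrite linearZZ vE.
  by rewrite /row_free => /eqP <-; exact: rank_leq_col.
move=> d' [phi' phi's phi'k]; apply/eqP; rewrite eqn_leq; apply/andP; split.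
  apply: (le_dim _ _ phi' phi) => // v v0.
  by have : [set D | phi' D = 0] v by rewrite phi'k -phi_boundaries.
apply: (le_dim _ _ phi phi') => // v v0.
by have : [set D | phi D = 0] v by rewrite phi_boundaries -phi'k.
Qed.

End HomToDim.
End Quotients.

Local Close Scope ring_scope.

(** * From rapid descent to largeness *)

(** Bernoulli's inequality for (1 + 1/a)^(a N), without denominators. *)
Lemma bernoulli_nat a N : (0 < a)%N -> (a ^ (a * N) * (1 + N) <= a.+1 ^ (a * N))%N.
Proof.
move=> a0; have key j : (a ^ j * (a + j) <= a.+1 ^ j * a)%N.
  elim: j => [|j IHj]; first by rewrite addn0.
  rewrite !expnS; move: IHj; set b := (a ^ j)%N; set c := (a.+1 ^ j)%N => IHj.
  nia.
have e : (a + a * N = (1 + N) * a)%N by rewrite mulnDl mul1n mulnC.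
by have := key (a * N)%N; rewrite e mulnA leq_pmul2r.
Qed.

Section Descent.
Variables (R : realType) (G : groupType) (p : nat) (H : groupClosed G)
  (S : nat -> groupClosed (subgroup H)).
Hypotheses (pp : prime p) (fH : finite_index H)
  (ser : abelian_p_series p S) (rapid : rapid_descent R p S).

Local Notation dimS i := (dim_H1 p (quotient_group (S i) (S i.+1))).

Lemma rapid_descent_nat : exists2 M : nat, (0 < M)%N &
  forall i, (subgroup_index (S i) <= M * dimS i)%N.
Proof.
move: rapid; rewrite /rapid_descent; set c := inf _; move=> c0.
have cE i : (c <= (dimS i)%:R / (subgroup_index (S i))%:R)%R.
  apply: ge_inf; last by exists i.
  by exists 0%R => _ [j _ <-]; rewrite divr_ge0.
pose M := Num.bound c^-1; have Mc : (c^-1 < M%:R)%R.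
  by rewrite archi_boundP// invr_ge0 ltW.
exists M; first by rewrite -(ltr_nat R) (lt_trans _ Mc)// invr_gt0.
move=> i; rewrite -(ler_nat R) natrM; have := cE i.
have [->|n0] := eqVneq (subgroup_index (S i)) 0%N; first by rewrite mulr_ge0.
have n0' : (0 < (subgroup_index (S i))%:R :> R)%R by rewrite ltr0n lt0n.
rewrite ler_pdivlMr// => cnd; apply: (le_trans (y := (c^-1 * (dimS i)%:R)%R)).
  by rewrite ler_pdivlMl.
by rewrite ler_wpM2r// ltW.
Qed.

(** The G-set of cosets of S i, seen as a subgroup of G. *)
Definition level (i : nat) (V : gset G) :=
  transitive_gset V /\
  forall g, act (base V) g = base V <-> exists2 h, h \in S i & val h = g.

Lemma level0 : exists V, level 0 V.
Proof.
have [V tV sV] := coset_gset fH; exists V; split=> // g; rewrite sV.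
have [S0 _ _ _] := ser; split=> [gH|[h _ <-]]; last exact: (valP h).
by exists (Sub g gH : subgroup H); rewrite ?S0 ?SubK.
Qed.

(** A point of V is determined by its image in V0 and by a coset of S i in H, once
    elements that move the base point of V0 to each point are chosen. *)
Lemma level_card i V0 V : level 0 V0 -> level i V ->
  (#|V| <= #|V0| * subgroup_index (S i))%N.
Proof.
move=> [tV0 sV0] [tV sV].
have /choice[g gE] : forall v : V, exists g, act (base V) g = v := tV.
have /choice[t tE] : forall v : V0, exists g, act (base V0) g = v := tV0.
pose bar v := act (base V0) (g v).
have /choice[h hE] (v : V) : exists h : subgroup H, val h = g v * (t (bar v))^-1.
  have /sV0[h _ hv] : act (base V0) (g v * (t (bar v))^-1) = base V0.
    by rewrite actM -[X in act X _]tE actK.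
  by exists h.
have [_ fS _ _] := ser.
have hF v : lcoset (h v)^-1 (S i) \in fset_set (lcosets (S i)).
  by rewrite (in_fset_set (fS i)) inE; exists (h v)^-1.
pose F v := (bar v, [` hF v]%fset).
have Finj : injective F.
  move=> v v' /eqP; rewrite xpair_eqE => /andP[/eqP ebar /eqP/(congr1 val) eF].
  have el : lcoset (h v)^-1 (S i) = lcoset (h v')^-1 (S i) by exact: eF.
  have : lcoset (h v')^-1 (S i) (h v')^-1 by apply/mem_lcoset; rewrite mulVg gpred1.
  rewrite -el => /mem_lcoset; rewrite invgK => hS.
  have : act (base V) (g v * (g v')^-1) = base V.
    apply/sV; exists (h v * (h v')^-1) => //.
    by rewrite valM -[val (h v')^-1]/((val (h v'))^-1) !hE ebar invgM invgK mulgA mulgVK.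
  by rewrite actM gE => /(congr1 (fun u => act u (g v'))); rewrite actKV gE.
have := leq_card F Finj; rewrite card_prod => /leq_trans; apply.
by rewrite leq_mul2l /subgroup_index cardfE leqnn orbT.
Qed.

Lemma level_step i V : level i V -> (0 < dimS i)%N ->
  exists2 u : V -> G -> 'rV['F_p]_(dimS i), onto_loops u &
    exists uc : cocycle u, level i.+1 (skew uc).
Proof.
move=> [tV sV] d0; have [_ _ nS eS] := ser.
have [th [thM ths thk]] := dim_H1_hom pp (nS i) (eS i) erefl d0.
pose th' (g : G) := th (insubd (1 : subgroup H) g).
have th'E h : th' (val h) = th h by rewrite /th' valKd.
have [|u uc uE] := @cocycle_of_hom _ V _ th' tV.
  move=> _ _ /sV[g gS <-] /sV[h hS <-].
  by rewrite -valM !th'E thM.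
have ul : onto_loops u.
  move=> a; have [g gS ga] := ths a; exists (val g); first by apply/sV; exists g.
  by rewrite uE ?th'E//; apply/sV; exists g.
exists u => //; exists uc; split; first exact: skew_transitive.
move=> g; split=> [[gb]|[h hS hg]].
  rewrite mul1g => gu; have /sV[h hS hg] := gb; exists h => //.
  by rewrite -thk// -th'E hg -uE// gu.
have hS' : h \in S i by exact: (nS i).1.
have gb : act (base V) g = base V by apply/sV; exists h.
rewrite act_skew /= gb mul1g uE// -hg th'E.
by move: hS; rewrite -thk// => /eqP ->.
Qed.

End Descent.

(** The density of the support decreases geometrically along the tower, whereas
    d_i >= |V_i| / M. So the hypothesis of [thin_large] holds far enough in the tower. *)
Lemma descent_large (R : realType) (G : groupType) (p : nat) (H : groupClosed G)
    (S : nat -> groupClosed (subgroup H)) :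
  finitely_presented G -> prime p -> finite_index H ->
  abelian_p_series p S -> rapid_descent R p S -> large G.
Proof.
move=> /finitely_presented_words[L [x [rs [presG genG]]]] pp fH ser rapid.
pose dS i := dim_H1 p (quotient_group (S i) (S i.+1)).
have [M M0 idx] := rapid_descent_nat rapid; have [V0 lV0] := level0 fH ser.
pose M' := (#|V0| * M)%N.
have V_gt0 (V : gset G) : (0 < #|V|)%N by apply/card_gt0P; exists (base V).
have M'0 : (0 < M')%N by rewrite muln_gt0 V_gt0.
have dV i V : level S i V -> (#|V| <= M' * dS i)%N.
  move=> lV; apply: leq_trans (level_card ser lV0 lV) _.
  by rewrite -mulnA leq_mul2l idx orbT.
have d_gt0 i V : level S i V -> (0 < dS i)%N.
  by move=> /dV; have := V_gt0 V; case: (dS i) => //; rewrite muln0; lia.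
have cardS (V : gset G) d (u : V -> G -> 'rV['F_p]_d) (uc : cocycle u) :
    #|skew uc| = (#|V| * p ^ d)%N.
  by rewrite card_skew; congr (_ * _)%N; exact: card_rVp.
have levels i : exists2 V, level S i V & (2 ^ i <= #|V|)%N.
  elim: i => [|i [V lV Vi]]; first by exists V0.
  have [u ul [uc lV']] := level_step pp ser lV (d_gt0 _ _ lV).
  exists (skew uc) => //; rewrite cardS expnSr leq_mul//.
  rewrite (leq_trans (prime_gt1 pp))// -{1}[p]expn1 leq_exp2l ?prime_gt1//.
    exact: d_gt0 lV.
(* With this m, d m exceeds |rs| |V| by d. It is kept opaque because p ^ m is rewritten
   below. *)
have [m mE] : exists m, m = (M' * size rs).+1 by exists (M' * size rs).+1.
(* Once |V| is at least K0, the surplus d covers the m^2 + m further conditions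
   of [shrink_support]; the 5 is room for the additive constant of [thin_large]. *)
pose K0 := (M' * (m * m + m + 5))%N.
have big_d i V : level S i V -> (K0 <= #|V|)%N -> (m * m + m + 5 <= dS i)%N.
  by move=> /dV VM KV; have := leq_trans KV VM; rewrite leq_pmul2l.
have enough i V : level S i V -> (K0 <= #|V|)%N ->
    (size rs * #|V| + m * m + m <= dS i * m)%N.
  move=> lV KV; have := big_d _ _ lV KV; have := dV _ _ lV.
  move=> nd md; rewrite [X in (_ <= _ * X)%N]mE mulnS.
  have h1 : (size rs * #|V| <= dS i * (M' * size rs))%N.
    by rewrite mulnC mulnA [(dS i * M')%N]mulnC leq_mul2r nd orbT.
  by rewrite -addnA [X in (_ <= X)%N]addnC leq_add// (leq_trans _ md)// leq_addr.
have towers j : exists (V : gset G) (w : V -> G -> 'rV['F_p]_m),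
    [/\ level S (K0 + j) V, (K0 <= #|V|)%N, cocycle w, onto_loops w &
      (#|support x w| * (p ^ m) ^ j <= (p ^ m - 1) ^ j * (#|L| * #|V|))%N].
  elim: j => [|j [V [w [lV KV wc wl wS]]]].
    have [V lV Vi] := levels K0; rewrite addn0.
    have KV : (K0 <= #|V|)%N by apply: leq_trans Vi; rewrite ltnW// ltn_expl.
    have [u ul [uc _]] := level_step pp ser lV (d_gt0 _ _ lV).
    have md : (m <= dS K0)%N by have := big_d _ _ lV KV; lia.
    exists V, (fun v g => u v g *m pid_mx m)%R; split=> //.
    - by move=> v g h; rewrite (cocycleD uc) mulmxDl.
    - move=> a; have [g gb gu] := ul (a *m pid_mx m)%R; exists g => //.
      by rewrite gu -mulmxA pid_mx_id// pid_mx_1 mulmx1.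
    - by rewrite muln1 mul1n mulnC -card_prod max_card.
  have [u ul [uc lV']] := level_step pp ser lV (d_gt0 _ _ lV).
  have [w' [w'c w'l w'S]] := shrink_support presG genG pp uc wc ul wl (enough _ _ lV KV).
  exists (skew uc), w'; rewrite addnS; split=> //.
    by rewrite cardS (leq_trans KV)// leq_pmulr// expn_gt0 prime_gt0.
  rewrite cardS !expnS.
  move: wS w'S; set s := #|_|; set s' := #|_|; set n := #|V|.
  set q := (p ^ m)%N; set D := (p ^ dim_H1 _ _)%N; set qj := (q ^ j)%N; set aj := ((q - 1) ^ j)%N.
  move=> h1 h2.
  apply: (@leq_trans ((q - 1) * D * s * qj)).
    by rewrite [X in (X <= _)%N]mulnA leq_mul2r h2 orbT.
  rewrite -mulnA; apply: (@leq_trans ((q - 1) * D * (aj * (#|L| * n)))).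
    by rewrite leq_mul2l h1 orbT.
  by rewrite -!mulnA leq_mul2l; apply/orP; right; rewrite mulnC -!mulnA.
pose C := (\sum_(r <- rs) size r ^ 2)%N.
(* Large enough for the support to have at most d / (2 (C + 1)) elements. *)
pose N := (2 * (C + 1) * (#|L| + 1) * M')%N.
have q1 : (1 < p ^ m)%N by rewrite -(exp1n m) ltn_exp2r ?mE// prime_gt1.
have [V [w [lV KV wc wl wS]]] := towers ((p ^ m - 1) * N)%N.
have [u ul [uc _]] := level_step pp ser lV (d_gt0 _ _ lV).
have j0 : 'I_m by rewrite mE; exact: ord0.
pose w0 v g := (w v g 0 j0)%R.
have w0c : cocycle w0 by move=> v g h; rewrite /w0 (cocycleD wc) mxE.
apply: (@thin_large G L x V p _ genG lV.1 pp u uc ul rs presG w0 w0c).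
  have [g gb gw] := wl (const_mx 1%R); exists g => //.
  by rewrite /w0 gw mxE oner_neq0.
set s0 := size _.
have s0S : (s0 <= #|support x w|)%N.
  rewrite /s0 -cardE; apply: subset_leq_card; apply/fintype.subsetP => e.
  by rewrite !inE; apply: contra => /eqP e0; rewrite /w0 e0 mxE.
have := bernoulli_nat N (_ : 0 < p ^ m - 1)%N; rewrite subn_gt0 q1 => /(_ isT).
have -> : (p ^ m - 1).+1 = (p ^ m)%N by rewrite subn1 prednK// ltnW.
have dbig := big_d _ _ lV KV.
have := dV _ _ lV; move: wS dbig s0S; rewrite -/C -/(dS _).
have : (0 < (p ^ m - 1) ^ ((p ^ m - 1) * N))%N by rewrite expn_gt0 subn_gt0 q1.
set a := ((_ - 1) ^ _)%N; set b := ((p ^ m) ^ _)%N; set d := dS _.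
set s := #|support x w|; set n := #|V| => a0 wS dbig s0S nd ab.
have h : (s * (1 + N) <= #|L| * n)%N.
  by rewrite -(leq_pmul2l a0) (leq_trans _ wS)// mulnCA leq_mul2l ab orbT.
have h' : (2 * ((C + 1) * s) <= d)%N.
  have k0 : (0 < (#|L| + 1) * M')%N by rewrite muln_gt0 addn1 M'0.
  rewrite -(leq_pmul2l k0).
  have -> : ((#|L| + 1) * M' * (2 * ((C + 1) * s)) = s * N)%N.
    by rewrite /N; ring.
  apply: (@leq_trans (s * (1 + N))); first by rewrite leq_mul2l leq_addl orbT.
  apply: (leq_trans h); rewrite -mulnA; apply: leq_mul => //; exact: leq_addr.
have h0 : ((C + 1) * s0 <= (C + 1) * s)%N by rewrite leq_mul2l s0S orbT.
by move: h' h0 dbig; lia.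
Qed.

(** * Covers of the rose with two petals *)

(** The edges outside a spanning tree, two per point minus those of the tree, are taken as
    coordinates: u sends each of them to its own basis vector, and the tree to zero. *)
Lemma free2_cover (p : nat) (V : gset free2) : transitive_gset V ->
  exists d (u : V -> free2 -> 'rV['F_p]_d),
    [/\ cocycle u, onto_loops u & (#|V| <= d)%N].
Proof.
move=> tV.
have conn (A : {set V}) : base V \in A ->
    (forall v l, v \in A -> act v (gen2 l) \in A) -> A = [set: V]%SET.
  move=> bA cA.
  have cAV v l : v \in A -> act v (gen2 l)^-1 \in A.
    move=> vA; pose f (v : V) := act v (gen2 l).
    have finj : injective f := can_inj (@actK _ V (gen2 l)).
    (* An injective map of the finite set A to itself is onto. *)
    have fA : f @: A = A.
      apply/eqP; rewrite eqEcard card_imset// leqnn andbT.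
      by apply/fintype.subsetP => _ /imsetP[v' v'A ->]; exact: cA.
    by move: vA; rewrite -{1}fA => /imsetP[v' v'A ->]; rewrite actK.
  apply/setP => v; rewrite inE; have [g <-] := tV v.
  rewrite (free2_word g); elim/last_ind: (to_word g) => [|s [l e] IHs].
    by rewrite /word_eval big_nil act1.
  rewrite -cats1 word_evalM actM /word_eval big_seq1 -/(word_eval gen2 s).
  by case: e => /=; [exact: cA | exact: cAV].
have [T Tn treeT] := spanning_tree conn.
pose d := #|~: T|; pose c (v : V) (l : bool) : 'rV['F_p]_d :=
  (\row_(j < d) ((v, l) == enum_val j)%:R)%R.
have [//|u uc uE] := @extend_cocycle _ _ gen2 [::] V _ c free2_presents.
have cT v l : (v, l) \in T -> c v l = 0%R.
  move=> vT; apply/rowP=> j; rewrite !mxE; case: eqP => // e.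
  by have := enum_valP j; rewrite -e inE vT.
exists d, u; split=> //; last first.
  have := cardsC T; rewrite card_prod card_bool -/d; lia.
have tree0 g : tree_path gen2 T g -> u (base V) g = 0%R.
  move=> tg; apply: (tg (fun g => u (base V) g = 0%R)) => [|h l uh hT].
    exact: cocycle1.
  by rewrite (cocycleD uc) uE uh cT// addr0.
apply: (@span_Fp p d (fun y => exists2 g, act (base V) g = base V & u (base V) g = y)).
- by exists 1; [exact: act1 | exact: cocycle1].
- move=> _ _ [g gb <-] [h hb <-]; exists (g * h); first by rewrite actM gb.
  by rewrite (cocycleD uc) gb.
- move=> s sI; apply/colP=> j; rewrite [RHS]mxE.
  case ej: (enum_val j) => [v l].
  have [g gv /tree0 g0] := treeT v; have [h hv /tree0 h0] := treeT (act v (gen2 l)).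
  have hV : act (act v (gen2 l)) h^-1 = base V by rewrite -hv actK.
  have ghb : act (base V) (g * gen2 l * h^-1) = base V by rewrite !actM gv hV.
  have := sI _ (ex_intro2 _ _ _ ghb erefl).
  rewrite !(cocycleD uc) g0 add0r gv uE actM gv.
  have := cocycleV uc (base V) h; rewrite hv h0 invg1 => ->.
  rewrite [(_ + _)%R](addr0 (c v l)).
  have -> : c v l = delta_mx 0%R j.
    apply/rowP=> k; rewrite !mxE eqxx -ej /= (inj_eq enum_val_inj).
    by rewrite eq_sym.
  by rewrite -rowE => /matrixP/(_ 0%R 0%R); rewrite !mxE.
Qed.

Lemma pullback_skew_quotient (K F : groupType) (pi : {hom K -> F}) (V : gset F) p d
    (u : V -> F -> 'rV['F_p]_d) (uc : cocycle u) :
  prime p -> surj_hom pi -> onto_loops u ->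
  let N := stab (pullback pi V) in let N' := stab (pullback pi (skew uc)) in
  [/\ normal_in N' N, elementary_abelian p (quotient_group N N') &
      dim_H1 p (quotient_group N N') = d].
Proof.
move=> pp sp ul N N'; pose th k := u (base V) (pi k).
have NE k : reflect (act (base V) (pi k) = base V) (k \in N) by exact: stabE.
have thM : {in N &, forall g h, th (g * h) = (th g + th h)%R}.
  by move=> g h /NE gN _; rewrite /th gmulfM (cocycleD uc) gN.
have ths y : exists2 g, g \in N & th g = y.
  have [g gb gy] := ul y; have [k kg] := sp g.
  by exists k; [apply/NE; rewrite kg | rewrite /th kg].
have thk g : (g \in N') = (g \in N) && (th g == 0%R).
  apply/stabE/andP.
    move=> e; have := e; rewrite [base _]base_skewD act_pullback act_skewD add0r.
    by case=> gb g0; split; [exact/NE | exact/eqP].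
  move=> [/NE gb /eqP g0]; rewrite [base _]base_skewD act_pullback act_skewD add0r.
  by rewrite gb -/(th g) g0.
split.
- exact: hom_normal_in thM thk.
- exact: (@hom_elementary_abelian _ _ _ _ pp _ th).
- exact: (@hom_dim_H1 _ _ _ _ _ th).
Qed.

(** Iterate [free2_cover] from the one-point cover. At each step the dimension exceeds the
    number of points, which is the index, so the ratio stays at least 1. *)
Lemma onto_free2_descent (R : realType) (p : nat) (K : groupType) (pi : {hom K -> free2}) :
  prime p -> surj_hom pi ->
  exists S : nat -> groupClosed K, abelian_p_series p S /\ rapid_descent R p S.
Proof.
move=> pp sp; pose state := {V : gset free2 | transitive_gset V}.
have /choice[nxt nxtP] (s : state) : exists s' : state,
    exists d (u : sval s -> free2 -> 'rV['F_p]_d) (uc : cocycle u),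
      [/\ sval s' = skew uc, onto_loops u & (#|sval s| <= d)%N].
  case: s => V tV; have [d [u [uc ul Vd]]] := free2_cover p tV.
  by exists (exist _ _ (skew_transitive (uc := uc) tV ul)), d, u, uc.
have act1u (v : unit) : (fun v (_ : free2) => v) v 1 = v by [].
have actMu (v : unit) g h :
  (fun v (_ : free2) => v) v (g * h) =
  (fun v (_ : free2) => v) ((fun v (_ : free2) => v) v g) h by [].
pose V0 := GSet tt act1u actMu.
have tV0 : transitive_gset V0 by case; exists 1.
pose st i : state := iter i nxt (exist _ V0 tV0).
pose S i := stab (pullback pi (sval (st i))).
have step i : exists d, [/\ normal_in (S i.+1) (S i),
    elementary_abelian p (quotient_group (S i) (S i.+1)),
    dim_H1 p (quotient_group (S i) (S i.+1)) = d & (subgroup_index (S i) <= d)%N].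
  have [d [u [uc [e ul Vd]]]] := nxtP (st i).
  have [n1 n2 n3] := pullback_skew_quotient uc pp sp ul.
  exists d; rewrite /S /st iterS -/(st i) e; split=> //.
  rewrite subgroup_index_stab//; apply: pullback_transitive => //.
  exact: (proj2_sig (st i)).
exists S; split; first split.
- by move=> k; rewrite inE; apply/stabE.
- by move=> i; exact: finite_index_stab.
- by move=> i; have [d []] := step i.
- by move=> i; have [d []] := step i.
apply: (lt_le_trans ltr01); apply: lb_le_inf; first by eexists; exists 0%N.
move=> _ [i _ <-]; have [d [_ _ -> Sd]] := step i.
have n0 : (0 < subgroup_index (S i))%N.
  rewrite subgroup_index_stab; last first.
    by apply: pullback_transitive => //; exact: (proj2_sig (st i)).
  by apply/card_gt0P; exists (base (sval (st i))).
by rewrite ler_pdivlMr ?ltr0n// mul1r ler_nat.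
Qed.

(** * The equivalence *)

Theorem theorem1p14 (R : realType) (G : groupType) (p : nat)
    (hG : finitely_presented G) (hp : prime p) :
  large G <->
  exists2 H : groupClosed G, finite_index H &
    exists S : nat -> groupClosed (subgroup H),
      abelian_p_series p S /\ rapid_descent R p S.
Proof.
split=> [[H fH [F [f [freeF nabF surjf]]]]|[H fH [S [ser rapid]]]].
  have [phi surjphi] := free_non_abelian_onto freeF nabF.
  have pM : {morph (fun h : subgroup H => phi (f h)) : g h / g * h}.
    by move=> g h; rewrite !gmulfM.
  exists H => //; apply: (@onto_free2_descent R p _ (hom_of pM)) => // y.
  by have [z <-] := surjphi y; have [k <-] := surjf z; exists k.
exact: descent_large rapid.
Qed.
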